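(* Let $K,L\ge 0$ be integers, $n=K+L+1$, and let $\mu=(K+1,1^L)$ be the corresponding hook partition of $n$. Let $\mathcal D$ be the set of drawings associated to $\mu$, and for $D\in\mathcal D$ let $\partial_D$ be the associated monomial derivative operator. Then the family $\{\partial_D\Delta_\mu\}_{D\in\mathcal D}$ spans the vector space $M_\mu$.
   Context: Let $K,L\ge 0$, $n=K+L+1$, $\mu=(K+1,1^L)$. All polynomials are in the variables $x_1,\dots,x_n,y_1,\dots,y_n$ over $\mathbb Q$. The set of biexponents of $\mu$ is $\{(0,0),(0,1),\dots,(0,K),(1,0),\dots,(L,0)\}$; list it in lexicographic order as $(p_1,q_1),\dots,(p_n,q_n)$ and set $\Delta_\mu=\det(x_i^{p_j}y_i^{q_j})_{1\le i,j\le n}$. $M_\mu$ is the linear span of all partial derivatives (of all orders, including order $0$) of $\Delta_\mu$ with respect to the variables $x_i,y_i$. A shape is a choice of $K$ of the places $1,\dots,K+L$ (numbered from left to right) to be $y$-columns, the $L$ other places being $x$-columns. From left to right the $y$-columns have $K,K-1,\dots,1$ cells and the $x$-columns have $L,L-1,\dots,1$ cells. A drawing $D$ consists of a shape together with, for each column, a number of crosses between $0$ and the number of cells of the column (cells without a cross are called white; only the number of crosses in each column matters), subject to the following rules. (1) The number of crosses in an $x$-column is arbitrary. (2) If a $y$-column has no $x$-column to its right, its number of crosses is arbitrary. If a $y$-column has some $x$-column to its right, consider the first (nearest) $x$-column to its right which is plain, i.e. all of whose cells are crossed (full) or all of whose cells are white (empty); one exists since the last $x$-column has one cell. If this plain $x$-column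 is empty, the $y$-column must have at least one cross; if it is full, the $y$-column must have at least one white cell. $\mathcal D$ is the set of all drawings. For a drawing $D$ with $c_i$ crosses at place $i$, $\partial_D=\prod_{i \text{ an }x\text{-column}}\partial_{x_i}^{c_i}\prod_{i\text{ a }y\text{-column}}\partial_{y_i}^{c_i}$. *)

(* Defs.v *)
From mathcomp Require Import all_boot all_algebra.
From mathcomp Require Import mpoly.

Set Implicit Arguments.
Unset Strict Implicit.
Unset Printing Implicit Defensive.

Import GRing.Theory.
Local Open Scope ring_scope.

Definition lin_span (R : nzRingType) (V : lmodType R) (I : Type) (F : I -> V)
    (v : V) : Prop :=
  exists s : seq (R * I), v = \sum_(a <- s) a.1 *: F a.2.

Definition spans (R : nzRingType) (V : lmodType R) (I : Type) (F : I -> V)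
    (U : V -> Prop) : Prop :=
  forall v : V, U v <-> lin_span F v.

Section Hook.

Variables K L : nat.

Notation n := (K + L).+1.

(* The x-variables are the first n of the n + n variables, the y-variables
   the last n. Rows and columns are numbered from 0. *)
Notation ring := {mpoly rat[n + n]}.

Definition xvar (i : 'I_n) : 'I_(n + n) := lshift n i.
Definition yvar (i : 'I_n) : 'I_(n + n) := rshift n i.

Definition biexponents : seq (nat * nat) :=
  [seq (0%N, q) | q <- iota 0 K.+1] ++ [seq (p, 0%N) | p <- iota 1 L].

Definition Delta : ring :=
  \det (\matrix_(i < n, j < n)
          let pq := nth (0%N, 0%N) biexponents j in
          'X_(xvar i) ^+ pq.1 * 'X_(yvar i) ^+ pq.2).

Definition M_mu : ring -> Prop :=
  lin_span (fun m : 'X_{1.. n + n} => mderivm m Delta).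

(* A shape is represented by the set Y of its y-columns (#|Y| = K); place i is
   an x-column when i \notin Y. *)
Definition height (Y : {set 'I_(K + L)}) (i : 'I_(K + L)) : nat :=
  if i \in Y then (K - #|[set k in Y | (k < i)%N]|)%N
  else (L - #|[set k in ~: Y | (k < i)%N]|)%N.

Definition plain (Y : {set 'I_(K + L)}) (c : {ffun 'I_(K + L) -> nat})
    (j : 'I_(K + L)) : bool :=
  (c j == height Y j) || (c j == 0%N).

Definition first_plain (Y : {set 'I_(K + L)}) (c : {ffun 'I_(K + L) -> nat})
    (i j : 'I_(K + L)) : Prop :=
  [/\ (i < j)%N, j \notin Y, plain Y c j &
      forall k : 'I_(K + L), (i < k < j)%N -> k \notin Y -> ~~ plain Y c k].

(* In drawing_ycol, no j exists exactly when there is no x-column to the right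
   of i (the last x-column has one cell, hence is plain), and then c i is
   unconstrained. Since all heights are positive, a plain x-column is either
   empty or full, not both. *)
Record drawing := Drawing {
  shape : {set 'I_(K + L)};
  crosses : {ffun 'I_(K + L) -> nat};
  drawing_shape : #|shape| = K;
  drawing_crosses : forall i, (crosses i <= height shape i)%N;
  drawing_ycol : forall i j, i \in shape -> first_plain shape crosses i j ->
    (crosses j = 0%N -> (0 < crosses i)%N) /\
    (crosses j = height shape j -> (crosses i < height shape i)%N)
}.

Definition column_var (Y : {set 'I_(K + L)}) (i : 'I_(K + L)) : 'I_(n + n) :=
  let i' := widen_ord (leqnSn (K + L)) i in
  if i \in Y then yvar i' else xvar i'.

Definition drawing_mnm (D : drawing) : 'X_{1.. n + n} :=
  (\sum_(i < K + L) U_(column_var (shape D) i) *+ crosses D i)%MM.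

Definition drawing_deriv (D : drawing) : ring -> ring :=
  mderivm (drawing_mnm D).

End Hook.

(* Main.v *)
Require Import Defs.
From mathcomp Require Import all_boot all_algebra.
From mathcomp Require Import mpoly.
From mathcomp Require Import all_fingroup zify ring.

(* Multiplying two monomial operators and reading off a coefficient of Delta gives
   a bilinear form on monomials whose kernel consists of the relations between
   the derivatives of Delta.

   Independence. Pair each drawing with the drawings whose crosses and white cells
   have been exchanged. Expanding along the first column, this square matrix is
   block triangular, and its diagonal blocks are again of this kind for one column
   less, provided one considers several hooks at the same time. Hence it is
   invertible.

   Spanning. Let S_n permute the n cells of the hook, viewed as n points of the
   plane; this gives n! points in affine 2n-space. For a monomial of degree at
   most that of Delta, its alternating sum over these points is proportional to
   its coefficient in Delta. So the top-degree part of a polynomial vanishing at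
   all the points annihilates Delta. Consequently drawings, being independent
   modulo the annihilator, are independent as functions on the points; as there
   are n! of them, every monomial coincides on the points with a combination of
   drawings, and comparing the parts of its degree gives a relation between
   derivatives of Delta.

   The two statements are proved together by induction on n: independence for
   n + 1 uses the span for n. *)

Set Implicit Arguments.
Unset Strict Implicit.
Unset Printing Implicit Defensive.

Import GRing.Theory Num.Theory.
Local Open Scope ring_scope.

(** * Coefficients of the hook determinants *)

Notation e0 := (0%N, 0%N).

(* A monomial is the list of its exponent pairs (x-exponent, y-exponent) at the
   successive places; reading it with default [e0] pads it with places of
   exponent zero. *)
Fixpoint mon_mul (s t : seq (nat * nat)) : seq (nat * nat) :=
  match s, t with
  | [::], _ => t
  | _, [::] => s
  | a :: s', b :: t' => ((a.1 + b.1)%N, (a.2 + b.2)%N) :: mon_mul s' t'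
  end.

Lemma nth_mon_mul s t i :
  nth e0 (mon_mul s t) i =
    (((nth e0 s i).1 + (nth e0 t i).1)%N, ((nth e0 s i).2 + (nth e0 t i).2)%N).
Proof.
elim: s t i => [|[a1 a2] s IH] [|[b1 b2] t] [|i] //=; rewrite ?nth_nil ?add0n ?addn0 //.
- by case: (nth _ _ _).
- by case: (nth _ _ _).
Qed.

Lemma mon_mulC s t : mon_mul s t = mon_mul t s.
Proof. by elim: s t => [|a s IH] [|b t] //=;
  rewrite IH [(a.1 + _)%N]addnC [(a.2 + _)%N]addnC. Qed.

(** This is the coefficient of the monomial [m] in the determinant of x_i^p y_i^q, where (p, q) is
    entry j of [B]. *)
Definition match_det N (B m : seq (nat * nat)) : rat :=
  \det (\matrix_(i < N, j < N) (nth e0 m i == nth e0 B j)%:R).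

Lemma eq_match_det N B m m' :
  (forall i, (i < N)%N -> nth e0 m i = nth e0 m' i) -> match_det N B m = match_det N B m'.
Proof. by move=> E; congr (\det _); apply/matrixP=> i j; rewrite !mxE E. Qed.

Lemma nth_rem (T : eqType) (x0 x : T) s j : x \in s ->
  nth x0 (rem x s) j = nth x0 s (bump (index x s) j).
Proof.
move=> xs; rewrite remE nth_cat /bump size_take index_mem xs.
case: (ltnP j) => H; first by rewrite nth_take.
by rewrite nth_drop; congr nth; lia.
Qed.

(** The entries of [B] are distinct, so the first row of the matrix has at most one nonzero
    entry. *)
Lemma match_det_cons N B e m : uniq B -> size B = N.+1 ->
  match_det N.+1 B (e :: m) =
    if e \in B then (-1) ^+ index e B * match_det N (rem e B) m else 0.
Proof.
move=> uB sB; rewrite /match_det (expand_det_row _ ord0).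
case: ifP => eB; last first.
  rewrite big1 // => j _; rewrite !mxE /=.
  case: eqP => [E|]; last by rewrite mul0r.
  by move: eB; rewrite E mem_nth // sB.
have lt : (index e B < N.+1)%N by rewrite -sB index_mem.
rewrite (bigD1 (Ordinal lt)) //= big1 ?addr0 => [|j Hj]; last first.
  rewrite !mxE /=; case: eqP => [E|]; last by rewrite mul0r.
  case/negP: Hj; apply/eqP/val_inj => /=.
  by rewrite E index_uniq // sB.
rewrite !mxE /= nth_index // eqxx mul1r /cofactor add0n; congr (_ * \det _).
by apply/matrixP=> i j; rewrite !mxE /= nth_rem.
Qed.

(* [n] is the number of places carrying a column, [l] the length of the leg: the
   hook with [l = L], [n = K + L], in the column order used by [Delta]. *)
Definition cells n l := biexponents (n - l) l.

Lemma size_cells n l : (l <= n)%N -> size (cells n l) = n.+1.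
Proof. by move=> H; rewrite size_cat !size_map !size_iota; lia. Qed.

Lemma mem_cells n l p q : (p, q) \in cells n l =
  ((p == 0%N) && (q <= n - l)%N || (q == 0%N) && (0 < p <= l)%N).
Proof.
rewrite mem_cat; congr (_ || _).
  apply/mapP/andP => [[i]|[/eqP-> H]].
    by rewrite mem_iota => H [-> ->]; split => //; lia.
  by exists q => //; rewrite mem_iota; lia.
apply/mapP/andP => [[i]|[/eqP-> H]].
  by rewrite mem_iota => H [-> ->]; split => //; lia.
by exists p => //; rewrite mem_iota; lia.
Qed.

Lemma uniq_cells n l : uniq (cells n l).
Proof.
rewrite cat_uniq !map_inj_uniq ?iota_uniq //=; try by move=> ? ? [].
rewrite andbT; apply/hasPn=> x /mapP[i]; rewrite mem_iota => Hi ->.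
rewrite inE negb_or; apply/andP; split; first by apply/eqP => -[]; lia.
by apply/mapP => -[j _ []]; lia.
Qed.

Definition hook_coeff n l := match_det n.+1 (cells n l).

Lemma hook_coeff_out n l e m : (l <= n)%N -> e \notin cells n l -> hook_coeff n l (e :: m) = 0.
Proof.
by move=> H /negbTE E; rewrite /hook_coeff match_det_cons ?uniq_cells ?size_cells // E.
Qed.

Lemma rem_mid (T : eqType) (x : T) s t : x \notin s -> rem x (s ++ x :: t) = s ++ t.
Proof.
elim: s => [|y s IH] /=; first by rewrite eqxx.
by rewrite inE negb_or eq_sym => /andP[/negbTE-> /IH->].
Qed.

(** Removing the end cell of the leg, or of the arm in the next lemma, leaves a smaller hook;
    expanding at such a cell allows induction on the number of places. *)
Lemma rem_cells_x n l : (l <= n)%N -> rem (l.+1, 0%N) (cells n.+1 l.+1) = cells n l.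
Proof.
move=> H; have -> : cells n.+1 l.+1 = cells n l ++ [:: (l.+1, 0%N)].
  by rewrite /cells subSS /biexponents -catA -[l.+1]addn1 iotaD map_cat add1n addn1.
by rewrite rem_mid ?cats0 // mem_cells; lia.
Qed.

Lemma rem_cells_y n l : (l <= n)%N -> rem (0%N, (n.+1 - l)%N) (cells n.+1 l) = cells n l.
Proof.
move=> H; rewrite /cells /biexponents subSn // -[(n - l).+2]addn1 iotaD map_cat -catA add0n.
apply: rem_mid.
by apply/mapP => -[q]; rewrite mem_iota => Hq []; lia.
Qed.

Lemma hook_coeff_xtop n l m : (l <= n)%N ->
  hook_coeff n.+1 l.+1 ((l.+1, 0%N) :: m) =
    (-1) ^+ index (l.+1, 0%N) (cells n.+1 l.+1) * hook_coeff n l m.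
Proof.
move=> H; rewrite /hook_coeff match_det_cons ?uniq_cells ?size_cells //.
by rewrite rem_cells_x // ifT // mem_cells; lia.
Qed.

Lemma hook_coeff_ytop n l m : (l <= n)%N ->
  hook_coeff n.+1 l ((0%N, (n.+1 - l)%N) :: m) =
    (-1) ^+ index (0%N, (n.+1 - l)%N) (cells n.+1 l) * hook_coeff n l m.
Proof.
move=> H; rewrite /hook_coeff match_det_cons ?uniq_cells ?size_cells //; try lia.
by rewrite rem_cells_y // ifT // mem_cells; lia.
Qed.

(** * Drawings as words *)

Notation letter := (bool * nat)%type.
Notation word := (seq letter).

(* A drawing is the list of its columns from left to right: [(true, c)] is a
   y-column and [(false, c)] an x-column, with [c] crosses. The height of a
   column is the number of columns of its kind from it on, so that it is
   determined by the suffix it starts. *)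
Definition ncol (b : bool) (w : word) := count (fun a => a.1 == b) w.
Notation nx := (ncol false).
Notation ny := (ncol true).

(* State of the first plain x-column: [Some true] if full, [Some false] if empty. *)
Fixpoint plain_type (w : word) : option bool :=
  if w is a :: u then
    if a.1 then plain_type u
    else if a.2 == 0%N then Some false
    else if a.2 == (nx u).+1 then Some true else plain_type u
  else None.

Definition letter_ok (a : letter) (u : word) : bool :=
  (a.2 <= (ncol a.1 u).+1)%N &&
  (a.1 ==> match plain_type u with
           | None => true
           | Some true => (a.2 < (ny u).+1)%N
           | Some false => (0 < a.2)%N
           end).

Fixpoint valid (w : word) : bool := if w is a :: u then letter_ok a u && valid u else true.

Fixpoint flip (w : word) : word :=
  if w is a :: u then (a.1, (ncol a.1 u).+1 - a.2)%N :: flip u else [::].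

Definition letter_exp (a : letter) : nat * nat := if a.1 then (0%N, a.2) else (a.2, 0%N).

Lemma ncol_size w : (ny w + nx w)%N = size w.
Proof. by rewrite -(count_predC (fun a : letter => a.1 == true)); congr addn;
  apply: eq_count => -[[] c]. Qed.

Lemma ncol_flip b w : ncol b (flip w) = ncol b w.
Proof. by elim: w => //= a u ->. Qed.

Lemma size_flip w : size (flip w) = size w.
Proof. by elim: w => //= a u ->. Qed.

Lemma plain_type_flip w : valid w -> plain_type (flip w) = omap negb (plain_type w).
Proof.
elim: w => //= -[[] c] u IH /= /andP[/andP[/= H _] /IH->] //.
rewrite subn_eq0 ncol_flip.
case: (eqVneq c 0%N) => [->|c0]; first by rewrite subn0 eqxx.
case: (eqVneq c (nx u).+1) => [->|c1]; first by rewrite leqnn.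
by rewrite leqNgt ltn_neqAle c1 H /= ifN //; lia.
Qed.

(** Exchanging colours swaps full and empty x-columns, hence also the two forms of the rule for
    y-columns. *)
Lemma valid_flip w : valid w -> valid (flip w).
Proof.
elim: w => //= -[b c] u IH /andP[ok v]; rewrite (IH v) andbT.
move: ok; rewrite /letter_ok /= !ncol_flip leq_subr plain_type_flip // => /andP[H].
by case: b H => //=; case: (plain_type u) => [[]|] //=; lia.
Qed.

Lemma flip_flip w : valid w -> flip (flip w) = w.
Proof.
elim: w => //= -[b c] u IH /andP[/andP[/= H _] v]; rewrite ncol_flip IH //.
by rewrite subKn.
Qed.

Lemma plain_type_nx0 w : nx w = 0%N -> plain_type w = None.
Proof. by elim: w => //= -[[] c] u IH //= E; apply: IH. Qed.

Lemma plain_type_nx w : valid w -> plain_type w = None -> nx w = 0%N.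
Proof.
elim: w => //= -[[] c] u IH /= /andP[/andP[/= H _] v] //.
  by rewrite add0n; apply: IH.
case: eqP => // c0; case: eqP => // c1 /(IH v) E; lia.
Qed.

Definition letters n : seq letter := [seq (b, c) | b <- [:: true; false], c <- iota 0 n].

Lemma mem_letters n a : (a \in letters n) = (a.2 < n)%N.
Proof.
case: a => b c; apply/allpairsP/idP => [[[b' c'] /= [_ H [_ ->]]]|H].
  by move: H; rewrite mem_iota.
by exists (b, c); split => //=; [case: (b)|rewrite mem_iota].
Qed.

Lemma uniq_letters n : uniq (letters n).
Proof. by rewrite allpairs_uniq ?iota_uniq // => -[? ?] [? ?] _ _ [-> ->]. Qed.

Fixpoint words n : seq word :=
  if n is k.+1 then
    [seq w <- [seq a :: u | a <- letters k.+2, u <- words k] | valid w]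
  else [:: [::]].

Lemma letter_ok_bound n a u : size u = n -> letter_ok a u -> (a.2 < n.+2)%N.
Proof. by move=> <- /andP[H _]; apply: leq_ltn_trans H _; rewrite !ltnS count_size. Qed.

Lemma wordsS n : words n.+1 = [seq w <- [seq a :: u | a <- letters n.+2, u <- words n] | valid w].
Proof. by []. Qed.

Arguments words : simpl never.

Lemma mem_words n w : (w \in words n) = valid w && (size w == n).
Proof.
elim: n w => [|n IH] [|a u].
- by rewrite inE.
- by rewrite inE andbF.
- by rewrite wordsS mem_filter; apply/negbTE/allpairsP => -[p [_ _]].
rewrite wordsS mem_filter [valid _]/= [size _]/= eqSS;
  case: (boolP (letter_ok a u && valid u)) => [/andP[ok v]|//]; rewrite !andTb.
apply/allpairsP/idP => [[[a' u'] /= [_ H [_ ->]]]|/eqP H].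
  by move: H; rewrite IH => /andP[].
by exists (a, u); split=> //=; rewrite ?IH ?v ?H ?eqxx // mem_letters (letter_ok_bound H).
Qed.

Lemma uniq_words n : uniq (words n).
Proof.
elim: n => // n IH; rewrite wordsS filter_uniq // allpairs_uniq ?uniq_letters //.
by move=> [? ?] [? ?] _ _ [-> ->].
Qed.

Lemma sum_words n (P : pred word) (f : word -> rat) :
  \sum_(w <- words n.+1 | P w) f w =
  \sum_(u <- words n) \sum_(a <- letters n.+2 | letter_ok a u && P (a :: u)) f (a :: u).
Proof.
rewrite wordsS big_filter_cond big_mkcond big_allpairs_dep exchange_big /=.
apply: eq_big_seq => u; rewrite mem_words => /andP[v _].
by rewrite [RHS]big_mkcond; apply: eq_bigr => a _; rewrite v andbT.
Qed.

(** Extracts a diagonal block: once the first letter is a function of the tail, the sum runs over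
    words with one column less. *)
Lemma sum_pick n (P : pred word) (f : word -> rat) (z : word -> letter) :
  (forall u a, u \in words n -> letter_ok a u -> P (a :: u) -> a != z u -> f (a :: u) = 0) ->
  \sum_(w <- words n.+1 | P w) f w =
  \sum_(u <- words n | letter_ok (z u) u && P (z u :: u)) f (z u :: u).
Proof.
move=> H; rewrite sum_words [RHS]big_mkcond; apply: eq_big_seq => u Hu.
rewrite big_mkcond /=; case: (boolP (letter_ok (z u) u)) => /= [ok|nok].
  rewrite (bigD1_seq (z u)) ?uniq_letters //=; last first.
    by rewrite mem_letters (letter_ok_bound _ ok) //; move: Hu;
      rewrite mem_words => /andP[_ /eqP].
  rewrite ok /= big1 ?addr0 // => a Ha.
  by case: ifP => // /andP[o p]; apply: H.
rewrite big1_seq // => a _; case: ifP => // /andP[o p]; apply: H => //.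
by apply: contraNneq nok => <-.
Qed.

Lemma perm_flip n : perm_eq (map flip (words n)) (words n).
Proof.
have HV w : w \in words n -> flip w \in words n.
  by rewrite !mem_words => /andP[/valid_flip-> /eqP E]; rewrite size_flip E /=.
have HK w : w \in words n -> flip (flip w) = w by rewrite mem_words => /andP[/flip_flip].
apply: uniq_perm (uniq_words n) _ => [|w].
  by rewrite map_inj_in_uniq ?uniq_words // => u w Hu Hw E; rewrite -(HK u) // E HK.
apply/mapP/idP => [[u Hu ->]|Hw]; first exact: HV.
by exists (flip w); [apply: HV|rewrite HK].
Qed.

Lemma sum_flip n (P : pred word) (f : word -> rat) :
  \sum_(w <- words n | P w) f w = \sum_(w <- words n | P (flip w)) f (flip w).
Proof. by rewrite -(perm_big _ (perm_flip n)) big_map. Qed.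

(** A square matrix over a field with trivial left kernel is invertible, so its right kernel is
    trivial too. *)
Lemma left_kernel_tr (I : eqType) (s : seq I) (g : I -> I -> rat) : uniq s ->
  (forall a, (forall v, v \in s -> \sum_(u <- s) a u * g u v = 0) ->
     forall u, u \in s -> a u = 0) ->
  forall b, (forall v, v \in s -> \sum_(u <- s) b u * g v u = 0) ->
     forall u, u \in s -> b u = 0.
Proof.
move=> us H b Hb u su; pose x0 := u.
pose M := \matrix_(i < size s, j < size s) g (nth x0 s i) (nth x0 s j).
have rf : row_free M.
  apply: inj_row_free => r rM.
  (* The row vector is read as a function on [I]; as [s] has no repetition, this sum has a single
     term at each entry of [s]. *)
  pose a x := \sum_(i < size s | nth x0 s i == x) r 0 i.
  have aE (i : 'I_(size s)) : a (nth x0 s i) = r 0 i.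
    rewrite /a (bigD1 i) //= big1 ?addr0 // => j /andP[].
    by rewrite nth_uniq // => /eqP/val_inj ->; rewrite eqxx.
  apply/rowP=> i; rewrite mxE -aE; apply: H; last exact: mem_nth.
  move=> v sv; have lt : (index v s < size s)%N by rewrite index_mem.
  rewrite (big_nth x0) big_mkord.
  move/rowP/(_ (Ordinal lt)): rM; rewrite !mxE => E; rewrite -[RHS]E.
  by apply: eq_bigr => j _; rewrite aE !mxE nth_index.
have fu : M \in unitmx by rewrite -row_free_unit.
pose r := \col_(i < size s) b (nth x0 s i).
have : M *m r = 0.
  apply/colP=> i; rewrite !mxE -[RHS](Hb (nth x0 s i)) ?mem_nth //.
  rewrite (big_nth x0) big_mkord; apply: eq_bigr => j _; rewrite !mxE mulrC //.
move/(congr1 (mulmx (invmx M))); rewrite mulmxA mulVmx // mul1mx mulmx0 => r0.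
have lt : (index u s < size s)%N by rewrite index_mem.
by move/colP/(_ (Ordinal lt)): r0; rewrite !mxE /= nth_index.
Qed.

(* Coefficient in the determinant of the hook of shape [v] (not [w]) of the
   product of the monomial of [w] and the monomial of [v] with colours
   exchanged. *)
Definition pairing n w v := hook_coeff n (nx v) (mon_mul (map letter_exp w) (map letter_exp
  (flip v))).

(** Sign of the expansion at the end of the arm or of the leg, according to the kind of the first
    column. *)
Definition pairing_sign n (a : letter) (v : word) : rat :=
  let l := nx (a :: v) in
  let e := if a.1 then (0, n.+1 - l)%N else (l, 0)%N in (-1) ^+ index e (cells n.+1 l).

Lemma pairing_sign_neq0 n a v : pairing_sign n a v != 0.
Proof. by rewrite /pairing_sign signr_eq0. Qed.

(** In both cases the crosses of [a] and the white cells of [z] add up to the height of [z], so the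
    exponent at the first place is the end cell of the arm or of the leg. *)
Lemma pairing_top n a u z v : size v = n -> (z.2 <= (ncol z.1 v).+1)%N ->
  a = z \/ a.2 = 0%N /\ z.2 = 0%N ->
  pairing n.+1 (a :: u) (z :: v) = pairing_sign n z v * pairing n u v.
Proof.
move=> sv Hz Haz; have := ncol_size v; rewrite sv => Hn.
rewrite /pairing /= /pairing_sign /=; case: z Hz Haz => -[] j /= Hz Haz.
  rewrite add0n -hook_coeff_ytop; last by lia.
  congr (hook_coeff _ _ (_ :: _)).
  by case: Haz => [->|[]]; rewrite /letter_exp /= ?add0n; case: a => -[] i /=; do ?move->;
    congr pair; lia.
rewrite add1n -hook_coeff_xtop; last by lia.
congr (hook_coeff _ _ (_ :: _)).
by case: Haz => [->|[]]; rewrite /letter_exp /= ?add0n; case: a => -[] i /=; do ?move->;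
    congr pair; lia.
Qed.

(** Each case puts the exponent at the first place outside the hook: too far along the axis of [z],
    off both axes, or too far in the direction of [a]. *)
Lemma pairing_zero n a u z v : size v = n -> (z.2 <= (ncol z.1 v).+1)%N ->
  [\/ a.1 = z.1 /\ (z.2 < a.2)%N,
      [/\ a.1 != z.1, (0 < a.2)%N & (z.2 < (ncol z.1 v).+1)%N] |
      a.1 != z.1 /\ ((if a.1 then n.+1 - nx (z :: v) else nx (z :: v)) < a.2)%N] ->
  pairing n.+1 (a :: u) (z :: v) = 0.
Proof.
move=> sv Hz Haz; have := ncol_size v; rewrite sv => Hn.
rewrite /pairing /=; apply: hook_coeff_out; first by case: z Hz {Haz} => -[] j /=; lia.
rewrite mem_cells.
by case: z Hz Haz => -[] j; case: a => -[] i /= Hz; rewrite /letter_exp /=;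
  case=> [[]|[]|[]] //=; lia.
Qed.

(** * Nondegeneracy of the pairing *)

(* All drawings with leg [L], and those with leg in (L, R] whose first plain
   x-column is full: removing an uncrossed first column from drawings of leg [L]
   leaves drawings of both legs [L - 1] and [L], and in the latter case the first
   plain x-column is full. Iterating this enlarges [R - L]. *)
Definition stratum L R w := (L <= nx w <= R)%N && ((nx w == L) || (plain_type w == Some true)).

Arguments ncol : simpl never.

Lemma stratum_y L R j u : stratum L R ((true, j) :: u) = stratum L R u.
Proof. by []. Qed.

Lemma stratum_x L R j u : stratum L R ((false, j) :: u) =
  (L <= (nx u).+1 <= R)%N &&
  (((nx u).+1 == L) || (j != 0%N) && ((j == (nx u).+1) || (plain_type u == Some true))).
Proof.
rewrite /stratum (_ : nx _ = (nx u).+1) // [plain_type _]/=.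
by case: (j == 0%N); case: (j == (nx u).+1).
Qed.

Lemma stratum_range L R w : stratum L R w -> (L <= nx w <= R)%N.
Proof. by case/andP. Qed.

(* [lia] becomes very slow if these hypotheses are left in the context. *)
Ltac slia :=
  repeat match goal with
  | H : is_true (stratum _ _ _) |- _ => apply stratum_range in H
  | H : is_true (letter_ok _ _) |- _ => clear H
  | H : is_true (valid _) |- _ => clear H
  | H : is_true (_ \in _) |- _ => clear H
  | H : is_true (_ != _ :> letter) |- _ => clear H
  | H : _ = _ :> bool |- _ => clear H
  | H : size _ = _ |- _ => clear H
  | H : forall _, _ |- _ => clear H
  | H := _ |- _ => clear H
  end; lia.

Lemma plain_typeE : ((Some true == Some true) = true) * ((Some false == Some true) = false) *
  ((None == Some true) = false) * ((Some true == None) = false) *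
  ((Some false == None) = false) * ((None == None :> option bool) = true).
Proof. by []. Qed.

Lemma plain_type_None u : valid u -> (plain_type u == None) = (nx u == 0%N).
Proof. by move=> v; apply/eqP/eqP; [apply: plain_type_nx|apply: plain_type_nx0]. Qed.

Definition nondeg n L R := forall c : word -> rat,
  (forall v, v \in words n -> stratum L R v ->
    \sum_(u <- words n | stratum L R u) c u * pairing n u v = 0) ->
  forall u, u \in words n -> stratum L R u -> c u = 0.

(** As [zeta] depends on [m] only while [Q] is arbitrary, this is a relation modulo the annihilator
    of the determinant of the hook. *)
Definition words_span n l := exists zeta : seq (nat * nat) -> word -> rat, forall m Q,
  hook_coeff n l (mon_mul m Q) =
  \sum_(d <- words n | nx d == l) zeta m d * hook_coeff n l (mon_mul (map letter_exp d) Q).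

Lemma words_facts n u : u \in words n -> [/\ valid u, size u = n & (ny u + nx u)%N = n].
Proof. by rewrite mem_words => /andP[v /eqP E]; split => //; rewrite ncol_size. Qed.

Lemma nondeg0 L R : nondeg 0 L R.
Proof.
move=> c H u; rewrite mem_words => /andP[_ /eqP/size0nil ->] TR.
have := H [::] isT TR; rewrite /words /= big_cons TR big_nil addr0.
by rewrite /pairing /hook_coeff /match_det det_mx11 mxE /= mulr1.
Qed.

(** These are the tails of leg [L] before which the rules allow a full y-column. *)
Definition top_nonfull L u := (nx u == L) && (plain_type u != Some true).

(* Exchanging colours transposes the pairing, and exchanges full and empty. *)
Lemma nondeg_flip n L : (0 < L)%N -> nondeg n L.-1 L ->
  forall b : word -> rat,
  (forall v, v \in words n -> (nx v == L.-1) || top_nonfull L v ->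
     \sum_(u <- words n | (nx u == L.-1) || top_nonfull L u)
       b u * hook_coeff n (nx u) (mon_mul (map letter_exp u) (map letter_exp (flip v))) = 0) ->
  forall u, u \in words n -> (nx u == L.-1) || top_nonfull L u -> b u = 0.
Proof.
move=> L0 NS b Hb.
have YT w : w \in words n -> (nx w == L.-1) || top_nonfull L w = stratum L.-1 L (flip w).
  move=> Hw; have [vw _ _] := words_facts Hw; have := plain_type_None vw.
  rewrite /top_nonfull /stratum ncol_flip plain_type_flip //; case: (plain_type w) => [[]|] /=;
    rewrite ?plain_typeE; lia.
have VB w : w \in words n -> flip w \in words n.
  by rewrite !mem_words => /andP[/valid_flip-> /eqP E]; rewrite size_flip E /=.
have BB w : w \in words n -> flip (flip w) = w by rewrite mem_words => /andP[/flip_flip].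
pose s := [seq w <- words n | stratum L.-1 L w].
have us : uniq s by rewrite filter_uniq ?uniq_words.
have NS' : forall a : word -> rat,
    (forall v, v \in s -> \sum_(u <- s) a u * pairing n u v = 0) ->
    forall u, u \in s -> a u = 0.
  move=> a Ha u; rewrite mem_filter => /andP[Tu Hu]; apply: NS => // v Hv Tv.
  by rewrite -big_filter; apply: Ha; rewrite mem_filter Tv.
move=> u Hu Yu.
have := left_kernel_tr us NS' (b := fun w => b (flip w)) _ (u := flip u).
rewrite BB //; apply; last by rewrite mem_filter VB // -YT // Yu.
move=> v; rewrite mem_filter => /andP[Tv Hv].
rewrite big_filter -[RHS](Hb (flip v)) ?VB //; last by rewrite YT ?BB ?VB.
rewrite [RHS]sum_flip big_seq_cond [RHS]big_seq_cond.
apply: eq_big => [w|w /andP[Hw _]].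
  by case: (boolP (w \in words n)) => // Hw; rewrite YT ?VB ?BB.
by rewrite /pairing mon_mulC ncol_flip BB.
Qed.

(* The coefficients of a left kernel vector vanish letter after letter, in the
   order: no cross; [(true, j)] for [j < K]; [(false, j)] for [j < L]; the two
   letters [(true, K)] and [(false, L)] together; [(false, j)] for [j > L]. With
   this order the pairing is block triangular. *)
Section Step.

Variables (n : nat) (c : word -> rat) (L R : nat).
Hypothesis LR : (L <= R)%N.
Hypothesis LN : (L <= n.+1)%N.
Hypothesis H : forall v, v \in words n.+1 -> stratum L R v ->
  \sum_(u <- words n.+1 | stratum L R u) c u * pairing n.+1 u v = 0.
Hypothesis IH : forall L R, nondeg n L R.

Lemma col_pick (z : word -> letter) v :
  v \in words n -> letter_ok (z v) v && stratum L R (z v :: v) ->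
  (forall u a, u \in words n -> letter_ok a u -> stratum L R (a :: u) -> a != z u ->
     c (a :: u) * pairing n.+1 (a :: u) (z v :: v) = 0) ->
  \sum_(u <- words n | letter_ok (z u) u && stratum L R (z u :: u))
    c (z u :: u) * pairing n.+1 (z u :: u) (z v :: v) = 0.
Proof.
move=> Hv /andP[ov tv] Hz; have [vv sv _] := words_facts Hv.
rewrite -(@sum_pick n (stratum L R) (fun w => c w * pairing n.+1 w (z v :: v)) z) //;
  apply: H => //.
by rewrite mem_words /= ov vv sv /=.
Qed.

(** Handles one diagonal block: when every other letter has zero coefficient or zero pairing,
    [pairing_top] turns the kernel equations into those of the stratum of tails, to which the
    induction hypothesis applies. *)
Lemma letter_stage (z : word -> letter) L' R' :
  (forall u, u \in words n -> letter_ok (z u) u && stratum L R (z u :: u) = stratum L' R' u) ->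
  (forall u v a, u \in words n -> v \in words n -> stratum L' R' v -> letter_ok a u ->
    stratum L R (a :: u) ->
     a != z u -> c (a :: u) = 0 \/ pairing n.+1 (a :: u) (z v :: v) = 0) ->
  (forall u v, z u = z v \/ (z u).2 = 0%N /\ (z v).2 = 0%N) ->
  forall u, u \in words n -> stratum L' R' u -> c (z u :: u) = 0.
Proof.
move=> HT H0 Hz; apply: (IH (c := fun u => c (z u :: u))) => v Hv Tv.
have okT : letter_ok (z v) v && stratum L R (z v :: v) by rewrite HT.
have [_ sv _] := words_facts Hv.
have /andP[Hzv _] : letter_ok (z v) v by case/andP: okT.
have S0 := col_pick Hv okT.
have {}S0 : \sum_(u <- words n | stratum L' R' u) c (z u ::
  u) * (pairing_sign n (z v) v * pairing n u v) = 0.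
  rewrite -[RHS]S0 => [|u a Hu oa Ta aN]; last first.
    by case: (H0 u v a) => // ->; rewrite ?mul0r ?mulr0.
  rewrite big_seq_cond [RHS]big_seq_cond; apply: eq_big => [u|u /andP[Hu _]].
    by case: (boolP (u \in words n)) => // Hu; rewrite HT.
  by rewrite pairing_top.
apply: (mulfI (pairing_sign_neq0 n (z v) v)); rewrite mulr0 -[RHS]S0 mulr_sumr.
by apply: eq_bigr => u _; rewrite mulrCA.
Qed.

Lemma zero_letter b u : u \in words n -> letter_ok (b, 0%N) u -> stratum L R ((b, 0%N) :: u) ->
  c ((b, 0%N) :: u) = 0.
Proof.
(* The tail decides the kind of an uncrossed first column. As an x-column it is plain and not full,
   so the total leg must be [L]; as a y-column it needs a tail of leg at least [L] whose first plain
   x-column is full or absent. *)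
have TE w : w \in words n -> letter_ok (L <= nx w, 0)%N w && stratum L R ((L <= nx w, 0)%N ::
  w) = stratum L.-1 R w.
  move=> Hw; have [vw sw _] := words_facts Hw; have := plain_type_None vw.
  rewrite /letter_ok; case: (leqP L (nx w)) => HL; rewrite ?stratum_y ?stratum_x /stratum;
    case: (plain_type w) => [[]|]; rewrite ?plain_typeE /=; lia.
move=> Hu ou Tu; have [vu su _] := words_facts Hu.
have Eb : b = (L <= nx u)%N.
  by move: Tu; case: b {ou}; rewrite ?stratum_y ?stratum_x /stratum; lia.
rewrite Eb; apply: (letter_stage (z := fun w => (L <= nx w, 0)%N) TE _ _ Hu) => //.
- move=> w v [b' j] Hw Hv _ ow Tw ne; right.
  have [_ sv _] := words_facts Hv.
  apply: pairing_zero => //=.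
  case: j ne ow Tw => [ne _|j _ _ _]; last first.
    case: (eqVneq b' (L <= nx v)%N) => Eb'; first by constructor 1.
    by constructor 2.
  move=> Tw; case/eqP: ne; congr pair; move: Tw.
  by case: b'; rewrite ?stratum_y ?stratum_x /stratum; clear; lia.
- by move=> w v; right.
- by rewrite -TE // -Eb ou.
Qed.

Lemma y_letter j u : (j < n.+1 - L)%N -> u \in words n -> letter_ok (true, j) u ->
  stratum L R ((true, j) :: u) -> c ((true, j) :: u) = 0.
Proof.
elim/ltn_ind: j u => j IHj u jK Hu ou Tu.
have [j0|j0] := posnP j; first by rewrite j0 in ou Tu *; apply: zero_letter.
(* For a tail of leg above [L] the first plain x-column is full, so [j] must stay below the height
   of the y-column, which means [nx w <= n - j]. *)
have TE w : w \in words n -> letter_ok (true, j) w && stratum L R ((true, j) :: w) =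
  stratum L (minn R (n - j)) w.
  move=> Hw; have [vw sw Ew] := words_facts Hw; have := plain_type_None vw.
  rewrite /letter_ok stratum_y /stratum; case: (plain_type w) => [[]|];
    rewrite ?plain_typeE /=; lia.
apply: (letter_stage (z := fun w => (true, j)) TE _ _ Hu) => //.
- move=> w v [b i] Hw Hv Tv ow Tw ne.
  have [_ sv Ev] := words_facts Hv.
  have [i0|i0] := posnP i; first by left; rewrite i0 in ow Tw *; apply: zero_letter.
  case: b ne ow Tw => ne ow Tw; last first.
    by right; apply: pairing_zero => //=; [|constructor 2; split => //=]; slia.
  case: (ltngtP i j) => ij.
  + by left; apply: IHj => //; slia.
  + by right; apply: pairing_zero => //=; [|constructor 1]; slia.
  + by move: ne; rewrite ij eqxx.
- by move=> w v; left.
- by rewrite -TE // ou.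
Qed.

Lemma x_letter j u : (j < L)%N -> u \in words n -> letter_ok (false, j) u ->
  stratum L R ((false, j) :: u) -> c ((false, j) :: u) = 0.
Proof.
elim/ltn_ind: j u => j IHj u jK Hu ou Tu.
have [j0|j0] := posnP j; first by rewrite j0 in ou Tu *; apply: zero_letter.
have TE w : w \in words n -> letter_ok (false, j) w && stratum L R ((false, j) :: w) =
  stratum L.-1 R.-1 w.
  move=> Hw; have [vw sw Ew] := words_facts Hw.
  rewrite /letter_ok stratum_x /stratum /=; case: (plain_type w) => [[]|];
    rewrite ?plain_typeE /=; lia.
apply: (letter_stage (z := fun w => (false, j)) TE _ _ Hu) => //.
- move=> w v [b i] Hw Hv Tv ow Tw ne.
  have [_ sv Ev] := words_facts Hv.
  have [i0|i0] := posnP i; first by left; rewrite i0 in ow Tw *; apply: zero_letter.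
  case: b ne ow Tw => ne ow Tw.
    by right; apply: pairing_zero => //=; [|constructor 2; split => //=]; slia.
  case: (ltngtP i j) => ij.
  + by left; apply: IHj => //; slia.
  + by right; apply: pairing_zero => //=; [|constructor 1]; slia.
  + by move: ne; rewrite ij eqxx.
- by move=> w v; left.
- by rewrite -TE // ou.
Qed.


Local Notation K := (n.+1 - L)%N.

Let z u := if top_nonfull L u then (true, K) else (false, L).
Let X := stratum L.-1 R.-1.
Let mm u v := mon_mul (map letter_exp u) (map letter_exp (flip v)).

Lemma hook_coeff_x l p m : (0 < l <= n.+1)%N -> p = (l, 0%N) ->
  hook_coeff n.+1 l (p :: m) = (-1) ^+ index (l, 0%N) (cells n.+1 l) * hook_coeff n l.-1 m.
Proof. by case: l => // l Hl ->; rewrite hook_coeff_xtop. Qed.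

Lemma hook_coeff_y l p m : (l <= n)%N -> p = (0%N, n.+1 - l)%N ->
  hook_coeff n.+1 l (p :: m) = (-1) ^+ index (0%N, n.+1 - l)%N (cells n.+1 l) * hook_coeff n l m.
Proof. by move=> Hl ->; rewrite hook_coeff_ytop. Qed.

(* In this diagonal block the words after [(false, L)] are those of [X], the words
   after [(true, K)] those of [top_nonfull L]. Words of [X] of leg at least [L] are
   first rewritten, modulo the annihilator for leg [L - 1], with words of leg
   [L - 1]; what remains is the block of [nondeg_flip]. *)
Section Block.

Hypothesis L0 : (0 < L)%N.

Lemma block_dom u : u \in words n -> letter_ok (z u) u && stratum L R (z u :: u) =
  top_nonfull L u || X u.
Proof.
move=> Hu; have [vu su Eu] := words_facts Hu; have := plain_type_None vu.
rewrite /z /X; case: ifP; rewrite ?stratum_y ?stratum_x /stratum /letter_ok /top_nonfull /=;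
  case: (plain_type u) => [[]|]; rewrite ?plain_typeE /=; lia.
Qed.

Lemma block_disj u : top_nonfull L u -> ~~ X u.
Proof. by rewrite /top_nonfull /X /stratum; case: (plain_type u == Some true); lia. Qed.

Lemma z_X u : X u -> z u = (false, L).
Proof. by move=> Xu; rewrite /z ifN //; apply: contraTN Xu => /block_disj. Qed.

(** Of the first letters outside the block, those that come earlier in the order have zero
    coefficient, and [(false, i)] with [i > L] pairs to zero with the test word. *)
Lemma block_eq v : v \in words n -> top_nonfull L v || X v ->
  \sum_(u <- words n | X u) c ((false, L) :: u) * pairing n.+1 ((false, L) :: u) (z v :: v) +
  \sum_(u <- words n | top_nonfull L u) c ((true, K) :: u) * pairing n.+1 ((true, K) ::
    u) (z v :: v) = 0.
Proof.
move=> Hv Yv.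
have okT : letter_ok (z v) v && stratum L R (z v :: v) by rewrite block_dom.
have [_ sv Ev] := words_facts Hv.
rewrite -[RHS](col_pick Hv okT) => [|u [b i] Hu ou Tu ne].
  rewrite [RHS](bigID X) /=; congr (_ + _); rewrite big_seq_cond [RHS]big_seq_cond.
    apply: eq_big => u; case: (boolP (u \in words n)) => //= Hu.
      by rewrite block_dom //; case: (X u); rewrite ?orbT ?andbF.
    by move=> /z_X->.
  apply: eq_big => u; case: (boolP (u \in words n)) => //= Hu.
    rewrite block_dom //; case: (boolP (top_nonfull L u)) => [/block_disj->|_] //=.
    by case: (X u).
  by move=> Eu; rewrite /z Eu.
have [vu su Eu] := words_facts Hu.
have [i0|i0] := posnP i; first by rewrite i0 in ou Tu *; rewrite zero_letter ?mul0r.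
case: b ne ou Tu => ne ou Tu.
  have [iK|iK] := ltnP i K; first by rewrite y_letter ?mul0r.
  case/eqP: ne; move: ou Tu; rewrite /z /top_nonfull /letter_ok stratum_y /stratum.
  case: (plain_type u) => [[]|]; rewrite ?plain_typeE /= ?andbT ?andbF ?orbT ?orbF => ou Tu.
  - by lia.
  - have -> /= : nx u == L by lia.
    by congr pair; lia.
  - have -> /= : nx u == L by lia.
    by congr pair; lia.
have [iL|iL] := ltnP i L; first by rewrite x_letter ?mul0r.
have [iL1|iL1] := ltnP L i; last first.
  case/eqP: ne; rewrite (_ : i = L); last by lia.
  rewrite /z; case: ifP => //; rewrite /top_nonfull => Eu'.
  move: ou Tu; rewrite stratum_x; case/andP: Eu' => /eqP-> /negbTE->.
  by lia.
rewrite [pairing _ _ _]pairing_zero ?mulr0 //; first by case/andP: okT => /andP[].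
rewrite /z; case: ifP => [/andP[/eqP EL _]|_]; last by constructor 1.
by constructor 3; rewrite /= (_ : nx _ = nx v) ?EL.
Qed.

Let sx : rat := (-1) ^+ index (L, 0%N) (cells n.+1 L).
Let sy : rat := (-1) ^+ index (0%N, K) (cells n.+1 L).

(** Here the x-column [(false, L)] of the test word is not full, so against [(true, K)] the first
    exponent lies off both axes and the second sum of [block_eq] vanishes. *)
Lemma block_eq1 v : v \in words n -> X v -> nx v != L.-1 ->
  \sum_(u <- words n | X u) c ((false, L) :: u) * pairing n u v = 0.
Proof.
move=> Hv Xv nv; have [vv sv Ev] := words_facts Hv.
have zv := z_X Xv.
have Lv : (L <= nx v)%N by move: Xv nv; rewrite /X /stratum; lia.
have := block_eq Hv; rewrite Xv orbT zv => /(_ isT).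
rewrite [X in _ + X]big1 ?addr0 => [E|u /andP[/eqP Lu _]]; last first.
  rewrite pairing_zero ?mulr0 //=; first by lia.
  constructor 2; split => //=; last by lia.
apply: (mulfI (pairing_sign_neq0 n (z v) v)); rewrite mulr0 -[RHS]E mulr_sumr zv.
by apply: eq_bigr => u _; rewrite mulrCA pairing_top //=; [lia|left].
Qed.

(** The first column of the test word is now full and contributes no exponent after the exchange of
    colours. The letter before [u] alone then selects the end of the leg or of the arm, which leaves
    hooks of leg [L.-1] and [L]. *)
Lemma block_eq2 v : v \in words n -> (nx v == L.-1) || top_nonfull L v ->
  sx * \sum_(u <- words n | X u) c ((false, L) :: u) * hook_coeff n L.-1 (mm u v) +
  sy * \sum_(u <- words n | top_nonfull L u) c ((true, K) :: u) * hook_coeff n L (mm u v) = 0.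
Proof.
move=> Hv Yv; have [vv sv Ev] := words_facts Hv.
have L1 : (0 < L <= n.+1)%N by rewrite L0.
have [E|nE] := eqVneq (nx v) L.-1.
  have Xv : X v by rewrite /X /stratum; lia.
  have := block_eq Hv; rewrite Xv orbT z_X // => /(_ isT) S0.
  rewrite -[RHS]S0 !mulr_sumr /pairing (_ : nx _ = L); last by rewrite -[RHS](prednK L0) -E.
  congr (_ + _).
    apply: eq_bigr => u _; rewrite mulrCA; congr (_ * _).
    by rewrite [map letter_exp (flip _)]/= [mon_mul _ _]/= hook_coeff_x //=; congr pair;
      rewrite E; lia.
  rewrite big_seq_cond [RHS]big_seq_cond; apply: eq_bigr => u /andP[Hu /andP[/eqP Lu _]].
  have [_ _ Eu] := words_facts Hu; rewrite mulrCA; congr (_ * _).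
  rewrite [map letter_exp (flip _)]/= [mon_mul _ _]/= hook_coeff_y //=; first by lia.
  by congr pair; rewrite ?E; lia.
have {nE} Ev' : top_nonfull L v by move: Yv; rewrite (negbTE nE).
have := block_eq Hv; rewrite Ev' /z Ev' => /(_ isT) S0.
have E : nx v = L by case/andP: Ev' => /eqP.
rewrite -[RHS]S0 !mulr_sumr /pairing (_ : nx _ = L) //.
congr (_ + _); apply: eq_bigr => u _; rewrite mulrCA; congr (_ * _).
  by rewrite [map letter_exp (flip _)]/= [mon_mul _ _]/= hook_coeff_x //=; congr pair; lia.
by rewrite [map letter_exp (flip _)]/= [mon_mul _ _]/= hook_coeff_y //=; [lia|congr pair; lia].
Qed.

Lemma block_zero : words_span n L.-1 -> forall u, u \in words n -> top_nonfull L u || X u ->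
  c (z u :: u) = 0.
Proof.
move=> [zeta Hz].
(* Once [zeta] has rewritten the tails in [X] with words of leg [L.-1], the equations [block_eq2]
   say that [b] satisfies the hypothesis of [nondeg_flip]. *)
pose b u := if nx u == L.-1
  then sx * \sum_(x <- words n | X x) c ((false, L) :: x) * zeta (map letter_exp x) u
  else sy * c ((true, K) :: u).
have sx0 : sx != 0 by rewrite signr_eq0.
have sy0 : sy != 0 by rewrite signr_eq0.
have red v : \sum_(u <- words n | X u) c ((false, L) :: u) * hook_coeff n L.-1 (mm u v) =
    \sum_(d <- words n | nx d == L.-1)
      (\sum_(x <- words n | X x) c ((false, L) :: x) * zeta (map letter_exp x) d) *
        hook_coeff n L.-1 (mm d v).
  under eq_bigr => u _ do rewrite /mm Hz mulr_sumr.
  rewrite exchange_big /=; apply: eq_bigr => d _; rewrite mulr_suml.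
  by apply: eq_bigr => x _; rewrite mulrA.
have b0 : forall u, u \in words n -> (nx u == L.-1) || top_nonfull L u -> b u = 0.
  apply: (nondeg_flip L0 (@IH L.-1 L)) => v Hv Yv.
  rewrite -[RHS](block_eq2 Hv Yv) red (bigID (fun u => nx u == L.-1)) /= !mulr_sumr.
  congr (_ + _).
    apply: eq_big => [u|u /andP[_ E]]; first by case: (_ == L.-1); rewrite ?orbT ?andbF.
    by rewrite /b E (eqP E) mulrA.
  apply: eq_big => [u|u /andP[Yu nE]].
    by case: (eqVneq (nx u)) => //= E; [rewrite /top_nonfull E; lia|rewrite andbT].
  by rewrite /b (negbTE nE); case/orP: Yu => [|/andP[/eqP-> _]];
    [rewrite (negbTE nE)|rewrite mulrA].
(* Since [b] vanishes, the sum over [X] is zero for test tails of leg [L.-1]; [block_eq1] covers the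
   other tails in [X]. *)
have cX u : u \in words n -> X u -> c ((false, L) :: u) = 0.
  apply: (IH (c := fun u => c ((false, L) :: u))) => v Hv Xv.
  have [Ev|] := eqVneq (nx v) L.-1; last by apply: block_eq1.
  rewrite /pairing Ev -/(mm _ v) [LHS]red big1_seq // => d /andP[Ed Hd].
  have := b0 d Hd; rewrite Ed /b Ed => /(_ isT) /eqP.
  by rewrite mulf_eq0 (negbTE sx0) /= => /eqP->; rewrite mul0r.
move=> u Hu; rewrite /z; case: ifP => /= [Eu _|_ Xu]; last exact: cX.
have := b0 u Hu; rewrite Eu orbT /b ifN => [/(_ isT) /eqP|].
  by rewrite mulf_eq0 (negbTE sy0) /= => /eqP->.
by case/andP: Eu => /eqP->; lia.
Qed.

End Block.

Hypothesis SP : (0 < L)%N -> words_span n L.-1.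

Lemma y_any j u : u \in words n -> letter_ok (true, j) u -> stratum L R ((true, j) :: u) ->
  c ((true, j) :: u) = 0.
Proof.
move=> Hu ou Tu; have [vu su Eu] := words_facts Hu; have FN := plain_type_None vu.
have [jK|jK] := ltnP j K; first exact: y_letter.
have [L0|L0] := posnP L; last first.
  have Eu' : top_nonfull L u.
    move: ou Tu FN; rewrite /letter_ok stratum_y /stratum /top_nonfull.
    by case: (plain_type u) => [[]|]; rewrite ?plain_typeE /=; lia.
  have := block_zero L0 (SP L0) Hu; rewrite Eu' /z Eu' => /(_ isT).
  by rewrite (_ : j = K) //; move: ou; rewrite /letter_ok /=; move: Eu'; rewrite /top_nonfull;
    lia.
(* For [L = 0] the only remaining y-letter is [(true, n.+1)], and such a column has no x-column to
   its right. *)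
have TE w : w \in words n -> letter_ok (true, n.+1) w && stratum L R ((true, n.+1) :: w) =
  stratum 0 0 w.
  move=> Hw; have [vw sw Ew] := words_facts Hw; have := plain_type_None vw.
  by rewrite /letter_ok stratum_y /stratum L0; case: (plain_type w) => [[]|];
    rewrite ?plain_typeE /=; lia.
have jn : j = n.+1 by move: ou; rewrite /letter_ok /=; lia.
rewrite jn; apply: (letter_stage (z := fun w => (true, n.+1)) TE _ _ Hu) => //.
- move=> w v [b i] Hw Hv Tv ow Tw ne.
  have [_ sv Ev] := words_facts Hv; have [_ sw Ew] := words_facts Hw.
  have [i0|i0] := posnP i; first by left; rewrite i0 in ow Tw *; apply: zero_letter.
  case: b ne ow Tw => ne ow Tw.
    have [iK|iK] := ltnP i K; first by left; apply: y_letter.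
    by case/eqP: ne; congr pair; case/andP: ow => /= ow _; slia.
  right; apply: pairing_zero => //=; first by slia.
  by constructor 3; split => //=; have -> : nx ((true, n.+1) :: v) = nx v by []; slia.
- by move=> w v; left.
- by rewrite -TE // -jn ou.
Qed.

Lemma x_any j u : u \in words n -> letter_ok (false, j) u -> stratum L R ((false, j) :: u) ->
  c ((false, j) :: u) = 0.
Proof.
elim/ltn_ind: j u => j IHj u Hu ou Tu.
have [j0|j0] := posnP j; first by rewrite j0 in ou Tu *; apply: zero_letter.
have [vu su Eu] := words_facts Hu.
case: (ltngtP j L) => jL; first exact: x_letter.
  have R0 : (0 < R)%N by move: Tu; rewrite stratum_x; lia.
  (* The total leg exceeds [L], so the first plain x-column is full: either it is this one, and the
     tail has leg [j.-1], or it lies in the tail. *)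
  have TE w : w \in words n -> letter_ok (false, j) w && stratum L R ((false, j) :: w) =
    stratum j.-1 R.-1 w.
    move=> Hw; have [vw sw Ew] := words_facts Hw.
    rewrite /letter_ok stratum_x /stratum /=; case: (plain_type w) => [[]|];
      rewrite ?plain_typeE /=; lia.
  apply: (letter_stage (z := fun w => (false, j)) TE _ _ Hu) => //.
  - move=> w v [b i] Hw Hv Tv ow Tw ne.
    have [_ sv Ev] := words_facts Hv.
    case: b ne ow Tw => ne ow Tw; first by left; apply: y_any.
    case: (ltngtP i j) => ij.
    + by left; apply: IHj => //; slia.
    + by right; apply: pairing_zero => //=; [|constructor 1]; slia.
    + by move: ne; rewrite ij eqxx.
  - by move=> w v; left.
  - by rewrite -TE // ou.
have L0 : (0 < L)%N by rewrite -jL.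
have nE : top_nonfull L u = false.
  by move: Tu; rewrite stratum_x /top_nonfull; case: (plain_type u == Some true); lia.
have XE : top_nonfull L u || X u.
  by rewrite -block_dom // /z nE; move: ou Tu; rewrite jL => -> ->.
have := block_zero L0 (SP L0) Hu XE.
by rewrite /z nE jL.
Qed.

End Step.

Lemma nondeg_step n : (forall L R, nondeg n L R) ->
  (forall l, (l <= n)%N -> words_span n l) -> forall L R, nondeg n.+1 L R.
Proof.
move=> IH SP L R c H w; rewrite mem_words; case: w => [|[b j] u] //= /andP[/andP[ou vu] su] Tu.
have Hu : u \in words n by rewrite mem_words vu.
have [_ _ Eu] := words_facts Hu.
have LR : (L <= R)%N by move: Tu; rewrite /stratum; lia.
have LN : (L <= n.+1)%N.
  by move: Tu; case: (b); rewrite ?stratum_y ?stratum_x /stratum; lia.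
have SP' : (0 < L)%N -> words_span n L.-1 by move=> L0; apply: SP; lia.
case: b ou Tu => ou Tu; first exact: (y_any LR LN H IH SP').
exact: (x_any LR LN H IH SP').
Qed.

(** * Evaluation on the orbit of the cells *)

Definition cell_deg (e : nat * nat) : nat := e.1 + e.2.
Definition mon_deg N (m : seq (nat * nat)) : nat := \sum_(i < N) cell_deg (nth e0 m i).

Lemma mon_deg_mul N s t : mon_deg N (mon_mul s t) = (mon_deg N s + mon_deg N t)%N.
Proof. by rewrite -big_split; apply: eq_bigr => i _; rewrite nth_mon_mul /cell_deg /=; lia. Qed.

(* The cells of the hook are also used as points of the plane. *)
Definition monom_at (e P : nat * nat) : rat := P.1%:R ^+ e.1 * P.2%:R ^+ e.2.

Lemma monom_at_mul e f P : monom_at ((e.1 + f.1)%N, (e.2 + f.2)%N) P =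
  monom_at e P * monom_at f P.
Proof. by rewrite /monom_at /= !exprD; ring. Qed.

(* [X ^ p] reduced modulo [qpoly K] agrees with it at 0, ..., K and has lower
   degree if [K < p]. *)
Definition qpoly K : {poly rat} := \prod_(i <- iota 0 K.+1) ('X - (i%:R)%:P).

Lemma qpoly_spec K p : exists r : {poly rat},
  (size r <= K.+1)%N /\ forall i, (i <= K)%N -> r.[i%:R] = i%:R ^+ p.
Proof.
have sq : size (qpoly K) = K.+2 by rewrite size_prod_XsubC size_iota.
exists ('X^p %% qpoly K); split.
  by rewrite -ltnS -sq ltn_modp -size_poly_eq0 sq.
move=> i iK; have := congr1 (horner^~ i%:R) (divp_eq 'X^p (qpoly K)).
rewrite hornerXn hornerD hornerM => ->.
suff -> : (qpoly K).[i%:R] = 0 by rewrite mulr0 add0r.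
rewrite horner_prod (bigD1_seq i) ?iota_uniq ?mem_iota //=.
by rewrite hornerXsubC subrr mul0r.
Qed.

Lemma vandermonde_inj K (f : nat -> rat) :
  (forall i, (i <= K)%N -> \sum_(j < K.+1) f j * i%:R ^+ j = 0) ->
  forall j, (j <= K)%N -> f j = 0.
Proof.
move=> H j jK; pose p := \poly_(i < K.+1) f i.
have p0 : p = 0.
  apply: (@roots_geq_poly_eq0 _ p [seq i%:R | i <- iota 0 K.+1]).
  - apply/allP => x /mapP[i]; rewrite mem_iota => Hi ->.
    by apply/rootP; rewrite horner_poly H.
  - rewrite map_inj_uniq ?iota_uniq // => a b /eqP.
    by rewrite eqr_nat => /eqP.
  - by rewrite size_map size_iota size_poly.
have : p`_j = 0 by rewrite p0 coef0.
by rewrite coef_poly ltnS jK.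
Qed.

Section Orbit.

Variables (n l : nat).
Hypothesis ln : (l <= n)%N.
Notation B := (cells n l).
Notation N := n.+1.

Lemma sum_cells (F : nat * nat -> rat) :
  \sum_(e <- B) F e = \sum_(q < (n - l).+1) F (0%N, nat_of_ord q) + \sum_(p < l) F (p.+1, 0%N).
Proof.
have E k (f : nat -> rat) : \sum_(q <- iota 0 k) f q = \sum_(q < k) f q.
  by rewrite -(big_mkord xpredT) /index_iota subn0.
by rewrite /cells /biexponents big_cat !big_map E (iotaDl 1 0) big_map E.
Qed.

(** A pure power is reduced modulo [qpoly], which lowers the degree if it is not a cell; a monomial
    with both exponents positive vanishes at all cells. *)
Lemma monom_expansion e : exists k : nat * nat -> rat,
  [/\ forall P, P \in B -> monom_at e P = \sum_(f <- B) k f * monom_at f P,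
      forall f, f \in B -> k f != 0 -> f = e \/ (cell_deg f < cell_deg e)%N &
      e \in B -> k e = 1].
Proof.
case: (boolP (e \in B)) => eB.
  exists (fun f => (f == e)%:R); split => [P HP|f _|_]; last by rewrite eqxx.
    rewrite (bigD1_seq e) ?uniq_cells //= eqxx mul1r big1 ?addr0 // => f /negbTE fe.
    by rewrite fe mul0r.
  by case: (f =P e) => [->|_]; [left|rewrite eqxx].
case: e eB => p q eB'; have := eB'; rewrite mem_cells => eB.
have [p0|p0] := posnP p.
  have [r [sr Hr]] := qpoly_spec (n - l) q.
  exists (fun f => if f.1 == 0%N then r`_(f.2) else 0); split.
  - case=> a b; rewrite mem_cells => Hab; rewrite sum_cells /= [X in _ + X]big1 ?addr0;
    last first.
      by move=> i _; rewrite mul0r.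
    rewrite /monom_at /= p0 expr0 mul1r -Hr; last by lia.
    by rewrite (horner_coef_wide _ sr); apply: eq_bigr => i _; rewrite ?expr0 ?mul1r.
  - case=> a b; rewrite mem_cells /cell_deg /= => Hab; case: (a =P 0%N) => [a0 _|_];
    last by rewrite eqxx.
    by right; lia.
  - by [].
have [q0|q0] := posnP q.
  have [r [sr Hr]] := qpoly_spec l p.
  exists (fun f => if f.2 == 0%N then r`_(f.1) else 0); split.
  - case=> a b; rewrite mem_cells => Hab.
    rewrite sum_cells big_ord_recl [X in _ + X + _]big1 => [|i _]; last by rewrite mul0r.
    rewrite addr0 /monom_at /= q0 !expr0 !mulr1 -Hr; last by lia.
    rewrite (horner_coef_wide _ sr) big_ord_recl ?expr0 mulr1; congr (_ + _).
    by apply: eq_bigr => i _; rewrite ?expr0 ?mulr1.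
  - case=> a b; rewrite mem_cells /cell_deg /= => Hab; case: (b =P 0%N) => [b0 _|_];
    last by rewrite eqxx.
    by right; lia.
  - by [].
exists (fun=> 0); split => [[a b]|f _|].
- rewrite mem_cells big1 => [Hab|f _]; last by rewrite mul0r.
  rewrite /monom_at /=; have [->|->] : a = 0%N \/ b = 0%N by lia.
    by rewrite expr0n (gtn_eqF p0) mul0r.
  by rewrite expr0n (gtn_eqF q0) mulr0.
- by rewrite eqxx.
- by [].
Qed.

(** The points of the arm see only the powers of y and the constant, which are removed first; the
    points of the leg then determine the powers of x. *)
Lemma cells_monom_inj (k : nat * nat -> rat) :
  (forall P, P \in B -> \sum_(f <- B) k f * monom_at f P = 0) ->
  forall f, f \in B -> k f = 0.
Proof.
move=> H.
have H1 q : (q <= n - l)%N -> k (0%N, q) = 0.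
  apply: (@vandermonde_inj _ (fun q => k (0%N, q))) => i Hi.
  have := H (0%N, i); rewrite mem_cells Hi => /(_ isT) S0.
  rewrite -[RHS]S0 sum_cells [X in _ + X]big1 ?addr0 => [|j _].
    by apply: eq_bigr => j _; rewrite /monom_at /= expr0 mul1r.
  by rewrite /monom_at /= expr0n mul0r mulr0.
have H2 p : (p <= l)%N -> k (p, 0%N) = 0.
  apply: (@vandermonde_inj _ (fun p => k (p, 0%N))) => i Hi.
  have [->|i0] := posnP i.
    rewrite big1 // => -[[|j] Hj] _ /=; first by rewrite H1 ?mul0r.
    by rewrite expr0n mulr0.
  have := H (i, 0%N); rewrite mem_cells i0 Hi orbT => /(_ isT) S0.
  rewrite -[RHS]S0 sum_cells [X in _ = X + _]big1 ?add0r => [|j _]; last first.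
    by rewrite /= H1 ?mul0r // -ltnS.
  rewrite big_ord_recl /= H1 // mul0r add0r.
  by apply: eq_bigr => j _; rewrite /monom_at /= expr0 mulr1.
by case=> p q; rewrite mem_cells => /orP[/andP[/eqP-> /H1]|/andP[/eqP-> /andP[_ /H2]]].
Qed.

Definition orbit_eval m (s : 'S_N) : rat := \prod_(i < N) monom_at (nth e0 m i) (nth e0 B (s i)).

Lemma orbit_eval_mul a b s : orbit_eval (mon_mul a b) s = orbit_eval a s * orbit_eval b s.
Proof. by rewrite -big_split; apply: eq_bigr => i _; rewrite nth_mon_mul monom_at_mul. Qed.

Definition orbit_alt m : rat := \sum_(s : 'S_N) (-1) ^+ s * orbit_eval m s.

Lemma nth_cells (i : 'I_N) : nth e0 B i \in B.
Proof. by rewrite mem_nth // size_cells. Qed.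

Lemma cells_nth e : e \in B -> exists i : 'I_N, e = nth e0 B i.
Proof.
move=> eB; have lt : (index e B < N)%N by rewrite -(size_cells ln) index_mem.
by exists (Ordinal lt); rewrite /= nth_index.
Qed.

Lemma sum_cells_ord (F : nat * nat -> rat) : \sum_(e <- B) F e = \sum_(i < N) F (nth e0 B i).
Proof. by rewrite (big_nth e0) size_cells // big_mkord. Qed.

Lemma hook_coeff_support m : hook_coeff n l m != 0 ->
  exists s : 'S_N, forall i : 'I_N, nth e0 m i = nth e0 B (s i).
Proof.
move=> nz; have /existsP[s /forallP Hs] : [exists s : 'S_N, [forall i :
  'I_N, nth e0 m i == nth e0 B (s i)]].
  apply: contraNT nz; rewrite negb_exists => /forallP H; apply/eqP.
  rewrite /hook_coeff /match_det /determinant big1 // => s _.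
  have := H s; rewrite negb_forall => /existsP[i Hi].
  by rewrite (bigD1 i) //= mxE (negbTE Hi) mul0r mulr0.
by exists s => i; apply/eqP.
Qed.

Lemma hook_coeff_deg m : hook_coeff n l m != 0 -> mon_deg N m = mon_deg N B.
Proof.
case/hook_coeff_support => s Hs; rewrite /mon_deg [RHS](reindex_inj (@perm_inj _ s)).
by apply: eq_bigr => i _; rewrite Hs.
Qed.

(* Reducing each factor of the monomial to the span of the cells factors the
   alternant as [det W * det A]; a permutation contributes to [det W] only if it
   does not increase any degree, hence, by the bound on the total degree, only if
   it matches the exponents with the cells exactly. *)
Lemma orbit_alt_hook_coeff : exists2 C : rat, C != 0 &
  forall m, (mon_deg N m <= mon_deg N B)%N -> orbit_alt m = hook_coeff n l m * C.
Proof.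
pose A := \matrix_(i < N, j < N) monom_at (nth e0 B i) (nth e0 B j).
exists (\det A).
  rewrite -unitfE -unitmxE -row_free_unit; apply: inj_row_free => r rA.
  pose k f := \sum_(i < N | nth e0 B i == f) r 0 i.
  have kE (i : 'I_N) : k (nth e0 B i) = r 0 i.
    rewrite /k (bigD1 i) //= big1 ?addr0 // => j /andP[].
    by rewrite nth_uniq ?uniq_cells ?size_cells // => /eqP/val_inj ->; rewrite eqxx.
  apply/rowP=> i; rewrite mxE -kE; apply: cells_monom_inj (nth_cells i) => P /cells_nth[j ->].
  move/rowP/(_ j): rA; rewrite !mxE => E; rewrite -[RHS]E sum_cells_ord.
  by apply: eq_bigr => a _; rewrite kE mxE.
move=> m Hm.
have [k Hk] := fin_all_exists (fun i : 'I_N => monom_expansion (nth e0 m i)).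
pose W := \matrix_(i < N, j < N) k i (nth e0 B j).
have -> : orbit_alt m = \det (W *m A).
  rewrite /orbit_alt /determinant; apply: eq_bigr => s _; congr (_ * _).
  apply: eq_bigr => i _; rewrite !mxE; have [HE _ _] := Hk i.
  rewrite (HE _ (nth_cells (s i))).
  by rewrite sum_cells_ord; apply: eq_bigr => j _; rewrite !mxE.
rewrite det_mulmx; congr (_ * _); rewrite /hook_coeff /match_det /determinant.
apply: eq_bigr => s _; congr (_ * _).
case: (boolP [forall i : 'I_N, nth e0 m i == nth e0 B (s i)]) => [/forallP Hs|].
  apply: eq_bigr => i _; rewrite !mxE Hs -(eqP (Hs i)).
  have [_ _ H] := Hk i; apply: H.
  by have := nth_cells (s i); rewrite -(eqP (Hs i)).
rewrite negb_forall => /existsP[i Hi].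
rewrite [RHS](bigD1 i) //= !mxE (negbTE Hi) mul0r.
apply/eqP; apply: contraNT Hi => /prodf_neq0 nz.
have Hle (j : 'I_N) : nth e0 B (s j) =
  nth e0 m j \/ (cell_deg (nth e0 B (s j)) < cell_deg (nth e0 m j))%N.
  have [_ H _] := Hk j; apply: H; first exact: nth_cells.
  by have := nz j isT; rewrite mxE.
have Hle' (j : 'I_N) : (cell_deg (nth e0 B (s j)) <= cell_deg (nth e0 m j))%N.
  by case: (Hle j) => [->|/ltnW].
case: (Hle i) => [->|lt] //; exfalso.
have E : mon_deg N B = (\sum_(j < N) cell_deg (nth e0 B (s j)))%N.
  by rewrite /mon_deg (reindex_inj (@perm_inj _ s)).
move: Hm; rewrite E /mon_deg (bigD1 i) //= [X in (_ <= X)%N](bigD1 i) //= leqNgt.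
by rewrite -addSn leq_add // leq_sum.
Qed.

(* The top-degree part of a polynomial vanishing on the orbit annihilates the
   determinant of the hook. *)
Lemma top_relation (I : eqType) (s : seq I) (a : I -> rat) (m : I -> seq (nat * nat)) d :
  (forall p, \sum_(t <- s) a t * orbit_eval (m t) p = 0) ->
  (forall t, t \in s -> a t != 0 -> (mon_deg N (m t) <= d)%N) ->
  forall Q, \sum_(t <- s | mon_deg N (m t) == d) a t * hook_coeff n l (mon_mul Q (m t)) = 0.
Proof.
move=> H Hd Q; have [C C0 HC] := orbit_alt_hook_coeff.
have [dQ|dQ] := eqVneq (mon_deg N Q + d)%N (mon_deg N B); last first.
  rewrite big1 // => t /eqP Et.
  have [->|/hook_coeff_deg] := eqVneq (hook_coeff n l (mon_mul Q (m t))) 0;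
    first by rewrite mulr0.
  by rewrite mon_deg_mul Et => E; rewrite E eqxx in dQ.
apply: (mulIf C0); rewrite mul0r.
transitivity (\sum_(t <- s) a t * orbit_alt (mon_mul Q (m t))); last first.
  transitivity (\sum_(p : 'S_N) (-1) ^+ p * orbit_eval Q p * \sum_(t <- s) a t * orbit_eval (m
    t) p).
    under [RHS]eq_bigr => p _ do rewrite mulr_sumr.
    rewrite [RHS]exchange_big /=; apply: eq_bigr => t _; rewrite mulr_sumr.
    by apply: eq_bigr => p _; rewrite orbit_eval_mul [RHS]mulrCA !mulrA.
  by rewrite big1 // => p _; rewrite H mulr0.
rewrite big_mkcond mulr_suml; apply: eq_big_seq => t ts.
have [->|a0] := eqVneq (a t) 0; first by rewrite !mul0r; case: ifP; rewrite ?mul0r.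
have dt := Hd t ts a0.
rewrite HC; last by rewrite mon_deg_mul; lia.
case: eqP => dd; first by rewrite mulrA.
have [->|/hook_coeff_deg] := eqVneq (hook_coeff n l (mon_mul Q (m t))) 0;
  first by rewrite !mul0r mulr0.
by rewrite mon_deg_mul; lia.
Qed.

End Orbit.

(** * Counting drawings, and spanning *)

Lemma count_interval N a b : (b <= N)%N ->
  count (fun j => a <= j < b)%N (iota 0 N) = (b - a)%N.
Proof.
move=> bN; suff -> M : count (fun j => a <= j < b)%N (iota 0 M) = (minn b M - a)%N by lia.
elim: M => [|M IH]; first by rewrite /=; lia.
by rewrite -addn1 iotaD count_cat IH /= add0n addn0; lia.
Qed.

Lemma count_letters N (P : pred letter) :
  count P (letters N) =
  (count (fun j => P (true, j)) (iota 0 N) + count (fun j => P (false, j)) (iota 0 N))%N.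
Proof. by rewrite /letters /= cats0 count_cat !count_map. Qed.

Lemma count_wordsS n (P : pred word) :
  (count P (words n.+1))%:R =
  \sum_(u <- words n) (count (fun a => letter_ok a u && P (a :: u)) (letters n.+2))%:R :> rat.
Proof.
rewrite -sum1_count natr_sum sum_words; apply: eq_bigr => u _.
by rewrite -sum1_count natr_sum.
Qed.

(** A y-column of height [n.+1 - l] has [n.+2 - l] possible numbers of crosses; the rule excludes
    exactly one of them if an x-column follows, and none if [l = 0]. *)
Lemma count_head n l u : u \in words n -> (l <= n.+1)%N ->
  count (fun a => letter_ok a u && (nx (a :: u) == l)) (letters n.+2) =
  ((nx u == l) * (n.+1 - l + (l == 0)) + ((nx u).+1 == l) * l.+1)%N.
Proof.
move=> Hu ln; have [vu su Eu] := words_facts Hu; have FN := plain_type_None vu.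
rewrite count_letters; congr (_ + _)%N.
  case: (eqVneq (nx u) l) => [El|nl]; last first.
    by rewrite mul0n (eq_count (a2 := pred0)) ?count_pred0 // => j; rewrite /= andbF.
  rewrite mul1n; case Eft: (plain_type u) FN => [[]|]; rewrite ?plain_typeE => FN.
  - rewrite (eq_count (a2 := fun j => 0 <= j < n.+1 - l)%N) => [|j];
    first by rewrite count_interval; lia.
    by rewrite andbT /letter_ok Eft /=; lia.
  - rewrite (eq_count (a2 := fun j => 1 <= j < n.+2 - l)%N) => [|j];
    first by rewrite count_interval; lia.
    by rewrite andbT /letter_ok Eft /=; lia.
  - rewrite (eq_count (a2 := fun j => 0 <= j < n.+2 - l)%N) => [|j];
    first by rewrite count_interval; lia.
    by rewrite andbT /letter_ok Eft /=; lia.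
have E j : nx ((false, j) :: u) = (nx u).+1 by [].
case: (eqVneq (nx u).+1 l) => [El|nl]; last first.
  rewrite mul0n (eq_count (a2 := pred0)) ?count_pred0 // => j.
  by rewrite /= ?E ?(negbTE nl) andbF.
rewrite mul1n (eq_count (a2 := fun j => 0 <= j < l.+1)%N) => [|j];
  first by rewrite count_interval; lia.
by rewrite /= ?E ?El ?eqxx andbT /letter_ok /= andbT; lia.
Qed.

(** By induction there are [(n.+1)!] tails of leg [l] and as many of leg [l.-1], extended in
    [n.+1 - l] and [l.+1] ways, in total [n.+2]. For [l = 0] or [l = n.+1] only one kind of tail
    exists, again with [n.+2] extensions. *)
Lemma count_words_nx n l : (l <= n)%N -> count (fun w => nx w == l) (words n) = (n.+1)`!.
Proof.
elim: n l => [|n IH] l ln; first by rewrite (_ : l = 0%N) //; lia.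
have IH' k : (\sum_(u <- words n) (nx u == k) = (k <= n) * (n.+1)`!)%N.
  case: leqP => [kn|kn].
    rewrite mul1n -(IH k) // -sum1_count [RHS]big_mkcond /=.
    by apply: eq_bigr => u _; case: eqP.
  rewrite big1_seq // => u /andP[_ Hu]; have [_ _ Eu] := words_facts Hu.
  by case: eqP => // E; lia.
apply/eqP; rewrite -(eqr_nat rat) count_wordsS -natr_sum eqr_nat.
rewrite (eq_big_seq (fun u => (nx u == l) * (n.+1 - l + (l == 0)) + ((nx u).+1 == l) * l.+1)%N);
  last by move=> u Hu; rewrite count_head.
rewrite big_split /= -!big_distrl /= IH'.
have -> : (\sum_(u <- words n) ((nx u).+1 == l) = (0 < l) * (n.+1)`!)%N.
  case: l ln => [|l] ln; first by rewrite big1.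
  by rewrite (IH' l) -ltnS ln.
rewrite [(n.+2)`!]factS; move: (n.+1)`! => f.
case: l ln => [|l] ln; first by rewrite /=; nia.
by case: leqP => ? /=; nia.
Qed.

Section Spanning.

Variables (n l : nat).
Hypothesis ln : (l <= n)%N.
Hypothesis NS : nondeg n l l.
Notation N := n.+1.
Let D := [seq w <- words n | nx w == l].
Notation mono := (map letter_exp).

Lemma mem_D w : (w \in D) = (nx w == l) && (w \in words n).
Proof. by rewrite mem_filter. Qed.

Lemma uniq_D : uniq D.
Proof. by rewrite filter_uniq ?uniq_words. Qed.

Lemma size_D : size D = #|'S_N|.
Proof. by rewrite size_filter count_words_nx // card_Sn. Qed.

Lemma hook_coeff_indep (a : word -> rat) :
  (forall Q, \sum_(w <- D) a w * hook_coeff n l (mon_mul Q (mono w)) = 0) ->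
  forall w, w \in D -> a w = 0.
Proof.
have TE w : stratum l l w = (nx w == l) by rewrite /stratum; lia.
move=> H w; rewrite mem_D => /andP[xw Hw]; apply: NS Hw _; rewrite ?TE // => v Hv.
rewrite TE => /eqP xv; rewrite -[RHS](H (mono (flip v))) big_filter.
by apply: eq_big => u; rewrite ?TE // /pairing xv mon_mulC.
Qed.

(** Descending induction on the degree: the top-degree part of the relation holds modulo the
    annihilator, so [hook_coeff_indep] kills it. The case [b = 0] is independence on the orbit;
    nonzero [b] bounds the degrees in an expansion of [m]. *)
Lemma orbit_eval_indep (a : word -> rat) b m :
  (forall s : 'S_N, \sum_(w <- D) a w * orbit_eval l (mono w) s = b * orbit_eval l m s) ->
  forall w, w \in D -> b = 0 \/ (mon_deg N m < mon_deg N (mono w))%N -> a w = 0.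
Proof.
move=> H; pose M := (\sum_(w <- D) mon_deg N (mono w))%N.
have HM w : w \in D -> (mon_deg N (mono w) <= M)%N.
  by move=> wD; rewrite /M (bigD1_seq w) ?uniq_D //= leq_addr.
suff Hk k w : w \in D -> b = 0 \/ (mon_deg N m < mon_deg N (mono w))%N ->
    (M < mon_deg N (mono w) + k)%N -> a w = 0.
  by move=> w wD bw; apply: (Hk M.+1 w) => //; lia.
elim: k w => [|k IH] w wD bw Mw; first by have := HM w wD; lia.
set d := mon_deg N (mono w) in bw Mw.
(* [None] stands for the monomial [m], moved to the left-hand side. *)
pose terms := None :: map Some D.
pose c (t : option word) := if t is Some w then a w else - b.
pose mm (t : option word) := if t is Some w then mono w else m.
have R : forall Q, \sum_(t <- terms | mon_deg N (mm t) == d) c t * hook_coeff n l (mon_mul Q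
  (mm t)) = 0.
  apply: top_relation => // [s|t].
    by rewrite big_cons big_map /= H mulNr addNr.
  rewrite inE => /orP[/eqP->|/mapP[w' w'D ->]] /=.
    by rewrite oppr_eq0; case: bw => [->|/ltnW //]; rewrite eqxx.
  apply: contraNT; rewrite -ltnNge => dw; apply/eqP; apply: IH => //; last by lia.
  by case: bw => [|bw]; [left|right; lia].
have := @hook_coeff_indep (fun w' => if mon_deg N (mono w') == d then a w' else 0) _ w wD.
rewrite eqxx; apply => Q; rewrite -[RHS](R Q) big_cons big_map /=.
have -> : (if mon_deg N m == d then - b * hook_coeff n l (mon_mul Q m) +
    \sum_(j <- D | mon_deg N (mono j) == d) a j * hook_coeff n l (mon_mul Q (mono j)) else
    \sum_(j <- D | mon_deg N (mono j) == d) a j * hook_coeff n l (mon_mul Q (mono j))) =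
    \sum_(j <- D | mon_deg N (mono j) == d) a j * hook_coeff n l (mon_mul Q (mono j)).
  case: eqP => // E; case: bw => [->|]; last by rewrite E ltnn.
  by rewrite oppr0 mul0r add0r.
rewrite [RHS]big_mkcond; apply: eq_bigr => w' _.
by case: eqP; rewrite ?mul0r.
Qed.

Lemma words_span_of_nondeg : words_span n l.
Proof.
pose wd i : word := nth [::] D i.
have wdD (i : 'I_#|'S_N|) : wd i \in D by rewrite mem_nth // size_D.
(* This matrix is square because there are as many drawings as permutations, by [size_D]. *)
pose E := \matrix_(i < #|'S_N|, j < #|'S_N|) orbit_eval l (mono (wd i)) (enum_val j).
pose a (r : 'rV[rat]_#|'S_N|) (w : word) := \sum_(i < #|'S_N| | wd i == w) r 0 i.
have aE r (i : 'I_#|'S_N|) : a r (wd i) = r 0 i.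
  rewrite /a (bigD1 i) //= big1 ?addr0 // => j /andP[].
  by rewrite nth_uniq ?uniq_D ?size_D // => /eqP/val_inj ->; rewrite eqxx.
have sumD (F : word -> rat) : \sum_(w <- D) F w = \sum_(i < #|'S_N|) F (wd i).
  by rewrite (big_nth [::]) big_mkord size_D.
have arE r (s : 'S_N) : \sum_(w <- D) a r w * orbit_eval l (mono w) s = (r *m E) 0 (enum_rank s).
  rewrite sumD !mxE; apply: eq_bigr => i _.
  by rewrite aE !mxE enum_rankK.
have uE : E \in unitmx.
  rewrite -row_free_unit; apply: inj_row_free => r rE.
  apply/rowP => i; rewrite mxE -aE.
  apply: (@orbit_eval_indep (a r) 0 [::]) (wdD i) _; last by left.
  by move=> s; rewrite arE rE mxE mul0r.
pose v m : 'rV_#|'S_N| := \row_j orbit_eval l m (enum_val j).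
(* Only words of the degree of [m] are kept: those of higher degree have coefficient zero by
   [orbit_eval_indep], and those of lower degree are not in the top-degree part. *)
pose zeta m w := if mon_deg N (mono w) == mon_deg N m then a (v m *m invmx E) w else 0.
exists zeta => m Q.
have Hs (s : 'S_N) : \sum_(w <- D) a (v m *m invmx E) w * orbit_eval l (mono w) s =
  1 * orbit_eval l m s.
  by rewrite arE mulmxKV // mxE enum_rankK mul1r.
pose terms := None :: map Some D.
pose c (t : option word) := if t is Some w then a (v m *m invmx E) w else - 1.
pose mm (t : option word) := if t is Some w then mono w else m.
have : \sum_(t <- terms | mon_deg N (mm t) == mon_deg N m) c t * hook_coeff n l (mon_mul Q (mm
  t)) = 0.
  apply: top_relation => // [s|t].
    by rewrite big_cons big_map /= Hs mul1r mulN1r addNr.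
  rewrite inE => /orP[/eqP->|/mapP[w' w'D ->]] //=.
  apply: contraNT; rewrite -ltnNge => dw; apply/eqP.
  by apply: orbit_eval_indep Hs _ w'D _; right.
rewrite big_cons /= eqxx big_map /= mulN1r => /eqP.
rewrite addrC subr_eq0 => /eqP ES; rewrite [mon_mul m Q]mon_mulC -ES.
rewrite -[RHS]big_filter -/D big_mkcond; apply: eq_bigr => w _.
by rewrite /zeta mon_mulC; case: eqP; rewrite ?mul0r // mon_mulC.
Qed.

End Spanning.

Lemma nondeg_all n L R : nondeg n L R.
Proof.
elim: n L R => [|n IH] L R; first exact: nondeg0.
by apply: nondeg_step => // l ln; apply: words_span_of_nondeg.
Qed.

Lemma words_span_all n l : (l <= n)%N -> words_span n l.
Proof. by move=> ln; apply: words_span_of_nondeg => //; apply: nondeg_all. Qed.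

(** * Back to polynomials and drawings *)

Lemma lin_span_sum (R : nzRingType) (V : lmodType R) (I : Type) (F : I -> V)
    (J : Type) (s : seq J) (P : pred J) (a : J -> R) (G : J -> V) :
  (forall j, P j -> lin_span F (G j)) -> lin_span F (\sum_(j <- s | P j) a j *: G j).
Proof.
move=> H; elim/big_ind: _ => [|u v [s1 ->] [s2 ->]|j Pj].
- by exists [::]; rewrite big_nil.
- by exists (s1 ++ s2); rewrite big_cat.
have [t ->] := H j Pj; exists [seq (a j * x.1, x.2) | x <- t].
by rewrite big_map scaler_sumr; apply: eq_bigr => x _; rewrite scalerA.
Qed.

Section Coefficients.

Variables K L : nat.
Notation n := (K + L)%N.
Notation N := n.+1.

Definition mcells (m : 'X_{1.. N + N}) : seq (nat * nat) :=
  [seq (m (lshift N i), m (rshift N i)) | i <- enum 'I_N].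

Lemma nth_mcells m (i : 'I_N) : nth e0 (mcells m) i = (m (lshift N i), m (rshift N i)).
Proof. by rewrite (nth_map i) ?size_enum_ord // nth_ord_enum. Qed.

Lemma cellsE : cells n L = biexponents K L.
Proof. by rewrite /cells addnK. Qed.

Lemma mcoeff_Delta m : (Delta K L)@_m = hook_coeff n L (mcells m).
Proof.
rewrite /Delta /hook_coeff /match_det /determinant raddf_sum /=; apply: eq_bigr => s _.
have -> (p : {mpoly rat[N + N]}) : ((-1) ^+ s * p)@_m = (-1) ^+ s * p@_m.
  by rewrite !mulr_sign; case: (odd_perm s); rewrite ?mcoeffN.
congr (_ * _).
pose e (i : 'I_N) := nth e0 (biexponents K L) (s i).
(* The single monomial that the permutation [s] contributes to the determinant. *)
pose M : 'X_{1.. N + N} :=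
  (\sum_(i < N) (U_(lshift N i) *+ (e i).1 + U_(rshift N i) *+ (e i).2))%MM.
have ME1 i : M (lshift N i) = (e i).1.
  rewrite mnm_sumE (bigD1 i) //= big1 => [|j ji].
    by rewrite mnmDE !mulmnE !mnm1E eqxx eq_rlshift; lia.
  by rewrite mnmDE !mulmnE !mnm1E eq_lshift eq_rlshift (negbTE ji); lia.
have ME2 i : M (rshift N i) = (e i).2.
  rewrite mnm_sumE (bigD1 i) //= big1 => [|j ji].
    by rewrite mnmDE !mulmnE !mnm1E eqxx eq_lrshift; lia.
  by rewrite mnmDE !mulmnE !mnm1E eq_rshift eq_lrshift (negbTE ji); lia.
transitivity (('X_[M] : {mpoly rat[N + N]})@_m).
  congr (_@_m); rewrite /M -mprodXE; apply: eq_bigr => i _.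
  by rewrite mxE /= mpolyXD -!mpolyXn.
rewrite mcoeffX.
have -> : (M == m) = [forall i : 'I_N, nth e0 (mcells m) i == e i].
  apply/eqP/forallP => [<- i|H].
    by rewrite nth_mcells ME1 ME2 -surjective_pairing.
  apply/mnmP => j; have := H _; move=> {}H.
  have {}H i : (m (lshift N i), m (rshift N i)) = e i by rewrite -nth_mcells; apply/eqP.
  by case: (split_ordP j) => i ->; rewrite ?ME1 ?ME2 -H.
case: forallP => [H|H].
  by rewrite big1 // => i _; rewrite mxE cellsE -/(e i) H.
have /existsP[i Hi] : [exists i : 'I_N, nth e0 (mcells m) i != e i].
  by rewrite -negb_forall; apply/forallP.
by rewrite (bigD1 i) //= mxE cellsE -/(e i) (negbTE Hi) mul0r.
Qed.

Definition factm (m : 'X_{1.. N + N}) : nat := (\prod_(i < N + N) (m i)`!)%N.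

Lemma factm_gt0 m : (0 < factm m)%N.
Proof. by rewrite prodn_gt0 // => i; apply: fact_gt0. Qed.

Lemma factm_split m : factm m =
  (\prod_(i < N) ((nth e0 (mcells m) i).1`! * (nth e0 (mcells m) i).2`!))%N.
Proof.
rewrite /factm big_split_ord /= big_split /=; congr (_ * _)%N;
  by apply: eq_bigr => i _; rewrite nth_mcells.
Qed.

Definition factcells : nat :=
  (\prod_(i < N) ((nth e0 (cells n L) i).1`! * (nth e0 (cells n L) i).2`!))%N.

(* The product of the factorials of the exponents is the same for all monomials of
   [Delta], so that up to nonzero factors depending on [m'] only, differentiating
   is shifting coefficients. *)
Lemma mcoeff_deriv m m' :
  ((Delta K L)^`M[m])@_m' * (factm m')%:R =
  hook_coeff n L (mon_mul (mcells m) (mcells m')) * factcells%:R.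
Proof.
have E : hook_coeff n L (mcells (m + m')) = hook_coeff n L (mon_mul (mcells m) (mcells m')).
  apply: eq_match_det => i Hi; have := nth_mcells _ (Ordinal Hi) => /= EE.
  by rewrite nth_mon_mul !EE !mnmDE.
rewrite mcoeff_mderivm mcoeff_Delta -E -[X in X * _]mulr_natr -mulrA -natrM.
have [->|nz] := eqVneq (hook_coeff n L (mcells (m + m'))) 0; first by rewrite !mul0r.
congr (_ * _%:R); have [s Hs] := hook_coeff_support nz.
transitivity (factm (m + m')).
  rewrite /factm -big_split /=; apply: eq_bigr => i _.
  by rewrite mnmDE -[in RHS](@ffact_fact _ (m i)) ?leq_addr // addKn.
rewrite factm_split /factcells [RHS](reindex_inj (@perm_inj _ s)).
by apply: eq_bigr => i _; rewrite Hs.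
Qed.

End Coefficients.

Lemma card_nth (T : Type) (x0 : T) (P : pred T) s p : size s = p ->
  #|[set i : 'I_p | P (nth x0 s i)]| = count P s.
Proof.
move=> sp; rewrite -sum1_card -sum1_count (big_nth x0) big_mkord sp.
by apply: eq_bigl => i; rewrite inE.
Qed.

Lemma card_nth_take (T : Type) (x0 : T) (P : pred T) s p (i : 'I_p) : size s = p ->
  #|[set k : 'I_p | P (nth x0 s k) & (k < i)%N]| = count P (take i s).
Proof.
move=> sp; have si : size (take i s) = i by rewrite size_takel // sp ltnW.
rewrite -sum1_card -sum1_count (big_nth x0) big_mkord si.
rewrite (big_ord_widen_cond p (fun k => P (nth x0 (take i s) k)) (fun=> 1%N)) ?(ltnW (ltn_ord
  i)) //.
by apply: eq_bigl => k; rewrite inE andbC [RHS]andbC; case: ltnP => //= ki; rewrite nth_take.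
Qed.

Lemma valid_drop i w : valid w -> valid (drop i w).
Proof. by elim: w i => [|a u IH] [|i] //= /andP[_ /IH]. Qed.

(** Links the recursion [plain_type] with the positional description used in [first_plain]. *)
Lemma plain_type_first u j a0 : (j < size u)%N -> ~~ (nth a0 u j).1 ->
  (nth a0 u j).2 = 0%N \/ (nth a0 u j).2 = nx (drop j u) ->
  (forall k, (k < j)%N -> ~~ (nth a0 u k).1 ->
     (nth a0 u k).2 <> 0%N /\ (nth a0 u k).2 <> nx (drop k u)) ->
  plain_type u = Some ((nth a0 u j).2 != 0%N).
Proof.
elim: u j => [|[b c] u IH] [|j] //= ju bj pj H.
  case: b bj {H} pj => //= _; rewrite (_ : nx _ = (nx u).+1) //.
  by case=> -> //=; rewrite eqxx.
have -> : plain_type u = Some ((nth a0 u j).2 != 0%N).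
  by apply: IH => // k kj bk; apply: (H k.+1).
case: b H => //= H; have [] := H 0%N isT isT.
by rewrite /= (_ : nx _ = (nx u).+1) // => /eqP/negbTE-> /eqP/negbTE->.
Qed.

Section WordDrawing.

Variables (K L : nat) (w : word).
Notation p := (K + L)%N.
Hypothesis vw : valid w.
Hypothesis sw : size w = p.
Hypothesis xw : nx w = L.
Notation a0 := (false, 0%N).

Let Y : {set 'I_p} := [set i : 'I_p | (nth a0 w i).1].
Let c : {ffun 'I_p -> nat} := [ffun i : 'I_p => (nth a0 w i).2].

Let yw : ny w = K.
Proof. by have := ncol_size w; rewrite sw xw; lia. Qed.

Lemma word_card : #|Y| = K.
Proof.
rewrite -[RHS]yw /ncol -(card_nth a0 (fun a => a.1 == true) sw).
by apply: eq_card => i; rewrite !inE; case: (_.1).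
Qed.

Lemma word_height (i : 'I_p) : height Y i = ncol (nth a0 w i).1 (drop i w).
Proof.
have E b : ncol b w = (ncol b (take i w) + ncol b (drop i w))%N.
  by rewrite -count_cat cat_take_drop.
rewrite /height inE; case: (nth a0 w i).1.
  rewrite (_ : #|_| = ncol true (take i w)); first by have := E true; rewrite yw; lia.
  rewrite /ncol -(card_nth_take a0 (fun a => a.1 == true) i sw); apply: eq_card => k;
    rewrite !inE.
  by case: (nth a0 w k).1.
rewrite (_ : #|_| = ncol false (take i w)); first by have := E false; rewrite xw; lia.
rewrite /ncol -(card_nth_take a0 (fun a => a.1 == false) i sw); apply: eq_card => k; rewrite !inE.
by case: (nth a0 w k).1.
Qed.

Lemma word_drop (i : 'I_p) : drop i w = nth a0 w i :: drop i.+1 w.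
Proof. by rewrite -drop_nth // sw. Qed.

Lemma word_letter_ok (i : 'I_p) : letter_ok (nth a0 w i) (drop i.+1 w).
Proof. by have := valid_drop i vw; rewrite word_drop => /andP[]. Qed.

Lemma word_heightS (i : 'I_p) :
  height Y i = (ncol (nth a0 w i).1 (drop i.+1 w)).+1.
Proof.
by rewrite word_height word_drop; case: (nth a0 w i) => b d; rewrite /ncol /= eqxx.
Qed.

Lemma word_crosses (i : 'I_p) : (c i <= height Y i)%N.
Proof. by rewrite word_heightS ffunE; case/andP: (word_letter_ok i). Qed.

Lemma word_plain_type (i j : 'I_p) : first_plain Y c i j ->
  plain_type (drop i.+1 w) = Some (c j != 0%N).
Proof.
case=> ij jY pj H.
have nthd (k : 'I_p) : (i < k)%N -> nth a0 (drop i.+1 w) (k - i.+1) = nth a0 w k.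
  by move=> ik; rewrite nth_drop subnKC.
have dropd (k : 'I_p) : (i < k)%N -> drop (k - i.+1) (drop i.+1 w) = drop k w.
  by move=> ik; rewrite drop_drop subnK.
have xE (k : 'I_p) : ~~ (nth a0 w k).1 -> height Y k = nx (drop k w).
  by rewrite word_height => /negbTE->.
move: jY pj; rewrite /plain inE ffunE => jY pj.
rewrite -(nthd j ij); apply: plain_type_first; rewrite ?nthd ?dropd //.
- by rewrite size_drop sw; have := ltn_ord j; lia.
- by rewrite -xE //; case/orP: pj => /eqP; [right|left].
move=> k kj; have kp : (k + i.+1 < p)%N by have := ltn_ord j; lia.
have := nthd (Ordinal kp); have := dropd (Ordinal kp); rewrite /= addnK.
move=> -> // => [|]; last by lia.
move=> -> // => [|]; last by lia.
move=> xk; have := H (Ordinal kp); rewrite /= inE /plain ffunE /= xE // => HH.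
have : ~~ (((nth a0 w (k + i.+1)).2 == nx (drop (k + i.+1) w)) || ((nth a0 w (k + i.+1)).2 ==
  0%N)).
  by apply: HH => //; lia.
by rewrite negb_or => /andP[/eqP ? /eqP].
Qed.

Lemma word_ycol (i j : 'I_p) : i \in Y -> first_plain Y c i j ->
  (c j = 0%N -> (0 < c i)%N) /\ (c j = height Y j -> (c i < height Y i)%N).
Proof.
move=> iY fp; have := word_letter_ok i; rewrite /letter_ok (word_plain_type fp).
move: iY; rewrite inE => iY; rewrite iY /= => /andP[_ H].
have ci : c i = (nth a0 w i).2 by rewrite ffunE.
split => cj; first by rewrite cj in H; rewrite ci.
rewrite word_heightS iY ci; move: H; rewrite cj.
by rewrite word_heightS.
Qed.

Definition word_drawing : drawing K L :=
  Drawing word_card word_crosses word_ycol.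

(** The index runs over all [p.+1] places; the last one carries no column and reads the default
    [e0]. *)
Lemma nth_word_mnm (i : 'I_p.+1) :
  nth e0 (map letter_exp w) i = nth e0 (mcells (drawing_mnm word_drawing)) i.
Proof.
have pick (g : nat -> nat) : (\sum_(k < p) ((k == i :> nat) * g k) = if i < p then g i else 0)%N.
  case: ltnP => ip.
    rewrite (bigD1 (Ordinal ip)) //= eqxx mul1n big1 ?addn0 // => k.
    by rewrite -val_eqE /= => /negbTE->.
  by rewrite big1 // => k _; rewrite (ltn_eqF (leq_trans (ltn_ord k) ip)).
have -> : nth e0 (map letter_exp w) i = if (i < p)%N then letter_exp (nth a0 w i) else e0.
  case: ltnP => ip; first by rewrite (nth_map a0) // sw.
  by rewrite nth_default // size_map sw.
have wE (k : 'I_p) : (widen_ord (leqnSn p) k == i) = (k == i :> nat) by [].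
rewrite nth_mcells /drawing_mnm [LHS]surjective_pairing !mnm_sumE; congr pair.
  rewrite (eq_bigr (fun k : 'I_p => (k == i :> nat) * (letter_exp (nth a0 w k)).1)%N) => [|k _].
    by rewrite (pick (fun k => (letter_exp (nth a0 w k)).1)); case: ifP.
  rewrite mulmnE mnm1E /column_var /= inE ffunE /letter_exp /xvar /yvar.
  by case: (nth a0 w k).1; rewrite ?eq_rlshift ?eq_lshift ?wE ?muln0.
rewrite (eq_bigr (fun k : 'I_p => (k == i :> nat) * (letter_exp (nth a0 w k)).2)%N) => [|k _].
  by rewrite (pick (fun k => (letter_exp (nth a0 w k)).2)); case: ifP.
rewrite mulmnE mnm1E /column_var /= inE ffunE /letter_exp /xvar /yvar.
by case: (nth a0 w k).1; rewrite ?eq_lrshift ?eq_rshift ?wE ?muln0.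
Qed.

End WordDrawing.

Lemma deriv_in_span (K L : nat) (m : 'X_{1.. (K + L).+1 + (K + L).+1}) :
  lin_span (fun D : drawing K L => drawing_deriv D (Delta K L)) ((Delta K L)^`M[m]).
Proof.
have [zeta Hz] := words_span_all (leq_addl K L).
pose word_mnm (w : word) : 'X_{1.. (K + L).+1 + (K + L).+1} :=
  [multinom (match split j with
             | inl i => (nth e0 (map letter_exp w) i).1
             | inr i => (nth e0 (map letter_exp w) i).2 end) | j < (K + L).+1 + (K + L).+1].
have mwE w (i : 'I_(K + L).+1) : nth e0 (mcells (word_mnm w)) i = nth e0 (map letter_exp w) i.
  rewrite nth_mcells !mnmE; case: split_ordP => j /eqP; rewrite ?eq_shift //.
  move=> /eqP<-; case: split_ordP => k /eqP; rewrite ?eq_shift // => /eqP<-.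
  by rewrite -surjective_pairing.
(* Compared coefficient by coefficient, this is the relation of [words_span] with [Q] taken to be
   [mcells m']; the factor [factm m'] is common to both sides. *)
have -> : (Delta K L)^`M[m] =
    \sum_(w <- words (K + L) | (w \in words (K + L)) && (nx w == L)) zeta (mcells m) w *:
      (Delta K L)^`M[word_mnm w].
  apply/mpolyP => m'.
  have F0 : (factm m')%:R != 0 :> rat by rewrite pnatr_eq0 -lt0n factm_gt0.
  apply: (mulIf F0); rewrite mcoeff_deriv Hz (raddf_sum (mcoeff m')) !mulr_suml -big_seq_cond.
  apply: eq_bigr => w _; rewrite /= mcoeffZ -[RHS]mulrA mcoeff_deriv mulrA.
  congr (_ * _ * _); apply: eq_match_det => i Hi.
  by rewrite !nth_mon_mul (mwE w (Ordinal Hi)).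
apply: lin_span_sum => w /andP[]; rewrite mem_words => /andP[vw /eqP sw] /eqP xw.
exists [:: (1, word_drawing vw sw xw)]; rewrite big_seq1 scale1r /drawing_deriv.
congr mderivm; apply/mnmP => j.
have H (i : 'I_(K + L).+1) := etrans (mwE w i) (nth_word_mnm vw sw xw i).
by case: (split_ordP j) => i ->; have := H i; rewrite !nth_mcells => -[].
Qed.

Theorem theorem1 (K L : nat) :
  spans (fun D : drawing K L => drawing_deriv D (Delta K L)) (@M_mu K L).
Proof.
move=> v; split => -[s ->]; last first.
  by exists [seq (x.1, drawing_mnm x.2) | x <- s]; rewrite big_map.
by apply: lin_span_sum => m _; apply: deriv_in_span.
Qed.
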